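(* Let $\Omega\subset\mathbb{R}^d$ be a bounded open polyhedron. Suppose $u_0\in C_b^4(\Omega)$ is the solution of the local problem $$-\Delta u_0=f_0 \ \text{ on }\Omega,\qquad u_0=g_0\ \text{ on }\partial\Omega .$$ Suppose the family of kernels $\{\gamma_\delta\}$ satisfies the standing kernel conditions (K1)--(K2) given in the context and $$G(\gamma_\delta):=\sup_{\mathbf{x}\in\widehat\Omega_\delta}\int_{B_\delta(\mathbf{x})\cap\widehat\Omega_\delta}\gamma_\delta(\mathbf{x},\mathbf{y})\,d\mathbf{y}\lesssim\delta^{-2}.$$ Let $u_\delta$ be the solution of the nonlocal problem $$-\mathcal{L}_\delta u_\delta=f_\delta\ \text{ on }\Omega,\qquad u_\delta=g_\delta\ \text{ on }\Omega_\delta^c .$$ If $\widetilde u_0$ is a $C^4$ extension of $u_0$ and, for $\mu=0$ or $\mu=1$, $$\|f_\delta-f_0\|_{C(\Omega)}=O(\delta^2),\qquad \|g_\delta-\widetilde u_0\|_{C(\Omega_\delta^c)}=O(\delta^{2+\mu}),$$ then $$\|u_\delta-u_0\|_{C(\Omega)}=O(\delta^2),\qquad \|u_\delta-\widetilde u_0\|_\delta=O\big(\delta^{(3+\mu)/2}\big).$$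
   Context: Notation. For $\delta>0$, $\Omega_\delta^c=\{\mathbf{y}\in\mathbb{R}^d\setminus\Omega:\ \mathrm{dist}(\mathbf{y},\partial\Omega)<\delta\}$ and $\widehat\Omega_\delta=\Omega\cup\Omega_\delta^c$. $B_\delta(\mathbf{x})$ is the Euclidean ball of radius $\delta$ centered at $\mathbf{x}$. $\|\cdot\|_{C(D)}$ is the supremum norm on $D$. $C_b^n(D)$ is the space of functions on $D$ whose derivatives of order $0,\dots,n$ are all continuous and bounded. All $O(\cdot)$ and $\lesssim$ are as $\delta\to0$, with constants independent of $\delta$. Kernel conditions. $\gamma_\delta(\mathbf{x},\mathbf{y})\ge 0$ is symmetric and (K1) $\gamma_\delta(\mathbf{x},\mathbf{y})=0$ for $\mathbf{y}\notin B_\delta(\mathbf{x})$; (K2) $\gamma_\delta$ is radial, $\gamma_\delta(\mathbf{x},\mathbf{y})=\widetilde\gamma_\delta(|\mathbf{y}-\mathbf{x}|)$, with $\widetilde\gamma_\delta(s)>0$ for $0<s<\delta$, $\widetilde\gamma_\delta\in L^1(0,\delta)$, and $w_d\int_0^\delta s^{d+1}\widetilde\gamma_\delta(s)\,ds=d$, where $w_d$ is the surface area of the unit sphere in $\mathbb{R}^d$. Nonlocal operator: $\mathcal{L}_\delta u(\mathbf{x})=2\int_{\mathbb{R}^d}(u(\mathbf{y})-u(\mathbf{x}))\gamma_\delta(\mathbf{x},\mathbf{y})\,d\mathbf{y}$ for $\mathbf{x}\in\Omega$. Energy norm: $\|u\|_\delta=\Big(\int_{\widehat\Omega_\delta}\int_{\widehat\Omega_\delta}(u(\mathbf{y})-u(\mathbf{x}))^2\gamma_\delta(\mathbf{x},\mathbf{y})\,d\mathbf{y}\,d\mathbf{x}\Big)^{1/2}$.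 A $C^n$ extension of a function $u$ on $\Omega$ is a function $\widetilde u\in C_b^n(\widehat\Omega_\delta)$ with $\widetilde u|_\Omega=u$; it is a single function, not varying with $\delta$. *)

(* Defs.v *)
From HB Require Import structures.
From mathcomp Require Import all_boot all_order all_algebra.
From mathcomp Require Import all_classical all_reals all_analysis.

Set Implicit Arguments.
Unset Strict Implicit.
Unset Printing Implicit Defensive.

Import Order.TTheory GRing.Theory Num.Theory.
Import numFieldNormedType.Exports.

Local Open Scope classical_set_scope.
Local Open Scope ring_scope.

(** ** Lebesgue measure on R^n *)

(* The sigma-algebra on row vectors generated by the coordinates, i.e. the
   Borel sets; it mirrors the library's instance on tuples. *)
Definition rV_display : measure_display. Proof. exact. Qed.

Section measurable_rV.
Context {R : realType} (n : nat).

Let coord (i : 'I_n) (v : 'rV[R]_n) : measurableTypeR R := v ord0 i.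

Let rV_set0 : g_sigma_preimage coord set0.
Proof. exact: sigma_algebra0. Qed.

Let rV_setC A : g_sigma_preimage coord A -> g_sigma_preimage coord (~` A).
Proof. exact: sigma_algebraC. Qed.

Let rV_bigcup (F : _^nat) : (forall i, g_sigma_preimage coord (F i)) ->
  g_sigma_preimage coord (\bigcup_i (F i)).
Proof. exact: sigma_algebra_bigcup. Qed.

HB.instance Definition _ := @isMeasurable.Build rV_display
  'rV[R]_n (g_sigma_preimage coord) rV_set0 rV_setC rV_bigcup.

Lemma measurable_coord (i : 'I_n) : measurable_fun setT (coord i).
Proof.
move=> _ Y mY; rewrite setTI; apply: sub_sigma_algebra => /=.
rewrite -bigcup_seq/=; exists i => /=; first by rewrite mem_index_enum.
by exists Y => //; rewrite setTI.
Qed.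

Lemma measurable_fun_rVP d (T : measurableType d) (f : T -> 'rV[R]_n) :
  (forall i, measurable_fun setT (fun t => coord i (f t))) ->
  measurable_fun setT f.
Proof.
move=> mf _ A mA; rewrite setTI.
have : g_sigma_preimage (fun i => coord i \o f) `<=` measurable.
  apply: smallest_sub; first exact: sigma_algebra_measurable.
  rewrite -bigcup_seq; apply: bigcup_sub => i _ B [C mC <-].
  exact: mf.
by apply; rewrite g_sigma_preimage_comp; exists A => //; rewrite setTI.
Qed.

End measurable_rV.

Section rV_cons.
Context {R : realType} (n : nat).

Definition rV_cons (p : measurableTypeR R * 'rV[R]_n) : 'rV[R]_n.+1 :=
  row_mx (p.1%:M : 'rV[R]_1) p.2.

Lemma rV_cons0 p : rV_cons p ord0 ord0 = p.1.
Proof.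
rewrite (_ : @ord0 n = lshift n (@ord0 0)); last exact/val_inj.
by rewrite [LHS]row_mxEl mxE eqxx.
Qed.

Lemma rV_consS p (i : 'I_n) : rV_cons p ord0 (lift ord0 i) = p.2 ord0 i.
Proof.
rewrite (_ : lift ord0 i = rshift 1 i); last exact/val_inj.
by rewrite [LHS]row_mxEr.
Qed.

Lemma measurable_rV_cons : measurable_fun setT rV_cons.
Proof.
apply: measurable_fun_rVP => i.
have [->|[j ->]] : i = ord0 \/ exists j, i = lift ord0 j.
  by case: (unliftP ord0 i) => [j ->|->]; [right; exists j|left].
- have -> : (fun p => rV_cons p ord0 ord0) = fst.
    by apply/funext => p; exact: rV_cons0.
  exact: measurable_fst.
- have -> : (fun p => rV_cons p ord0 (lift ord0 j)) =
      (fun v : 'rV[R]_n => (v ord0 j : measurableTypeR R)) \o snd.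
    by apply/funext => p; exact: rV_consS.
  by apply: measurableT_comp => //; exact: measurable_coord.
Qed.

Variable m : {sigma_finite_measure set 'rV[R]_n -> \bar R}.

Definition rV_cons_measure : set 'rV[R]_n.+1 -> \bar R :=
  pushforward (lebesgue_measure \x m)%E rV_cons.

Let rV_cons_pushforward : {measure set 'rV[R]_n.+1 -> \bar R} :=
  measure_function_pushforward__canonical__measure_function_Measure
    (lebesgue_measure \x m)%E measurable_rV_cons.

Let rV_cons_measure0 : rV_cons_measure set0 = 0%E.
Proof. exact: (measure0 rV_cons_pushforward). Qed.

Let rV_cons_measure_ge0 A : (0 <= rV_cons_measure A)%E.
Proof. exact: (measure_ge0 rV_cons_pushforward). Qed.

Let rV_cons_measure_sigma_additive : semi_sigma_additive rV_cons_measure.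
Proof. exact: (@measure_semi_sigma_additive _ _ _ rV_cons_pushforward). Qed.

HB.instance Definition _ := isMeasure.Build _ _ _ rV_cons_measure
  rV_cons_measure0 rV_cons_measure_ge0 rV_cons_measure_sigma_additive.

Definition rV_uncons (v : 'rV[R]_n.+1) : measurableTypeR R * 'rV[R]_n :=
  (v ord0 ord0, \row_j v ord0 (lift ord0 j)).

Lemma rV_consK : cancel rV_cons rV_uncons.
Proof.
move=> p; rewrite /rV_uncons rV_cons0 [RHS]surjective_pairing; congr pair.
by apply/rowP => j; rewrite mxE rV_consS.
Qed.

Lemma measurable_rV_uncons : measurable_fun setT rV_uncons.
Proof.
apply: measurable_fun_pair; first exact: measurable_coord.
apply: measurable_fun_rVP => j.
rewrite (_ : (fun _ => _) = fun v : 'rV[R]_n.+1 => v ord0 (lift ord0 j)).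
  exact: measurable_coord.
by apply/funext => v; rewrite mxE.
Qed.

Let rV_cons_measure_sigma_finite : sigma_finite setT rV_cons_measure.
Proof.
have [F TF Foo] : sigma_finite setT (lebesgue_measure \x m)%E.
  have /sigma_finiteP[F [TF ndF Foo]] := sigma_finiteT (@lebesgue_measure R).
  have /sigma_finiteP[G [TG ndG Goo]] := sigma_finiteT m.
  exists (fun k => F k `*` G k).
    rewrite -setXTT TF TG predeqE => -[x y]; split.
      move=> [/= [i _ Fx] [j _ Gy]]; exists (maxn i j) => //; split.
      + by move: x Fx; exact/subsetPset/ndF/leq_maxl.
      + by move: y Gy; exact/subsetPset/ndG/leq_maxr.
    by move=> [i _ []/= ? ?]; split; exists i.
  move=> k; have [? ?] := Foo k; have [? ?] := Goo k.
  split; first exact: measurableX.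
  by rewrite product_measure1E// lte_mul_pinfty// ge0_fin_numE.
exists (fun k => rV_uncons @^-1` F k).
  by rewrite -preimage_bigcup -TF preimage_setT.
move=> k; split.
  by rewrite -[X in measurable X]setTI; apply: measurable_rV_uncons => //; case: (Foo k).
rewrite /rV_cons_measure /pushforward (_ : _ @^-1` _ = F k).
  by case: (Foo k).
by apply/seteqP; split => p /=; rewrite rV_consK.
Qed.

HB.instance Definition _ := Measure_isSigmaFinite.Build _ _ _ rV_cons_measure
  rV_cons_measure_sigma_finite.

End rV_cons.

Fixpoint lebesgue_rV_rec (R : realType) n :
    {sigma_finite_measure set 'rV[R]_n -> \bar R} :=
  match n with
  | 0 => dirac (0 : 'rV[R]_0)
  | n'.+1 => rV_cons_measure (lebesgue_rV_rec R n')
  end.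

Definition lebesgue_rV {R : realType} {n : nat} : set 'rV[R]_n -> \bar R :=
  lebesgue_rV_rec R n.

HB.instance Definition _ (R : realType) n :=
  SigmaFiniteMeasure.on (@lebesgue_rV R n).

Lemma measurable_rV_box (R : realType) n (A : 'I_n -> set (measurableTypeR R)) :
  (forall i, measurable (A i)) ->
  measurable [set v : 'rV[R]_n | forall i, A i (v ord0 i)].
Proof.
move=> mA; rewrite (_ : [set _ | _] =
    \bigcap_(i in [set: 'I_n]) ((fun v : 'rV[R]_n => v ord0 i) @^-1` A i)).
  apply: fin_bigcap_measurable => // i _; rewrite -[X in measurable X]setTI.
  exact: (measurable_coord i measurableT (mA i)).
by apply/seteqP; split => v /= h i => [_|]; exact: h.
Qed.

Lemma lebesgue_rV_box (R : realType) n (A : 'I_n -> set (measurableTypeR R)) :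
  (forall i, measurable (A i)) ->
  lebesgue_rV [set v : 'rV[R]_n | forall i, A i (v ord0 i)] =
    (\prod_(i < n) lebesgue_measure (A i))%E.
Proof.
elim: n A => [|n IH] A mA.
  by rewrite big_ord0 /lebesgue_rV /= diracE mem_set// => -[].
rewrite big_ord_recl -(IH (fun i => A (lift ord0 i))) //.
rewrite /lebesgue_rV /= {1}/rV_cons_measure /pushforward.
rewrite (_ : _ @^-1` _ = A ord0 `*`
    [set v : 'rV[R]_n | forall i, A (lift ord0 i) (v ord0 i)]).
  rewrite product_measure1E//.
  exact: (@measurable_rV_box R n (fun i => A (lift ord0 i)) (fun i => mA _)).
apply/seteqP; split => p /=.
  by move=> h; split=> [|i]; [rewrite -rV_cons0|rewrite -rV_consS]; exact: h.
move=> [h0 h] i; have [j ->|->] := unliftP ord0 i.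
- by rewrite rV_consS; exact: h.
- by rewrite rV_cons0.
Qed.

(** ** Euclidean geometry of R^d *)

Definition dotrV {R : realType} {d : nat} (a x : 'rV[R]_d) : R :=
  \sum_(i < d) a ord0 i * x ord0 i.

(* The library's norm on row vectors is the sup norm. *)
Definition enorm {R : realType} {d : nat} (x : 'rV[R]_d) : R :=
  Num.sqrt (dotrV x x).

Definition eball {R : realType} {d : nat} (x : 'rV[R]_d) (r : R) :
    set 'rV[R]_d :=
  [set y | enorm (y - x) < r].

(* Extended-real valued, so that the distance to the empty set is +oo. *)
Definition dist_to {R : realType} {d : nat} (y : 'rV[R]_d) (A : set 'rV[R]_d) :
    \bar R :=
  ereal_inf [set (enorm (y - z))%:E | z in A].

Definition boundary {T : topologicalType} (A : set T) : set T :=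
  closure A `\` interior A.

Definition convex_polyhedron {R : realType} {d : nat}
    (hs : seq ('rV[R]_d * R)) : set 'rV[R]_d :=
  [set x | forall h, h \in hs -> dotrV h.1 x <= h.2].

(* A bounded open polyhedron, not necessarily convex or connected: the interior
   of a finite union of closed convex polyhedra, each one an intersection of
   finitely many closed half-spaces. *)
Definition bounded_open_polyhedron {R : realType} {d : nat}
    (Omega : set 'rV[R]_d) : Prop :=
  bounded_set Omega /\
  exists ps : seq (seq ('rV[R]_d * R)),
    Omega = interior (\bigcup_(hs in [set` ps]) convex_polyhedron hs).

(* Surface measure on the unit sphere through polar coordinates:
   sigma(A) = d * |{r w : 0 < r <= 1, w in A}|. *)
Definition sphere_measure {R : realType} {d : nat} (A : set 'rV[R]_d) : \bar R :=
  (d%:R%:E * lebesgue_rV ([set r *: w | r in `]0, 1]%classic & w in A])%R)%E.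

Definition sphere_area (R : realType) (d : nat) : R :=
  fine (sphere_measure [set w : 'rV[R]_d | enorm w = 1]).

(** ** Function spaces and the local problem *)

Definition partial {R : realType} {d : nat} (i : 'I_d) (f : 'rV[R]_d -> R) :
    'rV[R]_d -> R :=
  'D_(delta_mx ord0 i : 'rV[R]_d) f.

(* C_b^n(D) for an open set D; only the values of f on D matter. *)
Fixpoint Cb {R : realType} {d : nat} (n : nat) (D : set 'rV[R]_d)
    (f : 'rV[R]_d -> R) : Prop :=
  [/\ {within D, continuous f},
      [bounded f x | x in D] &
      if n is n'.+1 then
        forall i : 'I_d,
          (forall x, D x -> derivable f x (delta_mx ord0 i : 'rV[R]_d)) /\
          Cb n' D (partial i f)
      else True].

Definition laplacian {R : realType} {d : nat} (f : 'rV[R]_d -> R)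
    (x : 'rV[R]_d) : R :=
  \sum_(i < d) partial i (partial i f) x.

(* The boundary values are attained as limits from inside Omega, the solution
   being a function on Omega. *)
Definition local_solution {R : realType} {d : nat} (Omega : set 'rV[R]_d)
    (f0 g0 u0 : 'rV[R]_d -> R) : Prop :=
  (forall x, Omega x -> - laplacian u0 x = f0 x) /\
  (forall x, boundary Omega x -> u0 y @[y --> within Omega (nbhs x)] --> g0 x).

(** ** The nonlocal problem *)

Definition collar {R : realType} {d : nat} (Omega : set 'rV[R]_d) (delta : R) :
    set 'rV[R]_d :=
  [set y | ~ Omega y /\ (dist_to y (boundary Omega) < delta%:E)%E].

Definition ext_domain {R : realType} {d : nat} (Omega : set 'rV[R]_d)
    (delta : R) : set 'rV[R]_d :=
  Omega `|` collar Omega delta.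

Definition Cn_extension {R : realType} {d : nat} (n : nat)
    (Omega : set 'rV[R]_d) (delta : R) (u ut : 'rV[R]_d -> R) : Prop :=
  Cb n (ext_domain Omega delta) ut /\ (forall x, Omega x -> ut x = u x).

Record kernel_conditions {R : realType} {d : nat} (delta : R)
    (gam : 'rV[R]_d -> 'rV[R]_d -> R) : Prop := KernelConditions {
  kernel_ge0 : forall x y, 0 <= gam x y ;
  kernel_sym : forall x y, gam x y = gam y x ;
  kernel_support : forall x y, ~ eball x delta y -> gam x y = 0 ;
  kernel_radial : exists gt : R -> R,
    [/\ forall x y, gam x y = gt (enorm (y - x)),
        forall s, 0 < s < delta -> 0 < gt s,
        lebesgue_measure.-integrable `]0, delta[%classic (EFin \o gt) &
        sphere_area R d *
          (\int[lebesgue_measure]_(s in `]0, delta[%classic)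
             (s ^+ d.+1 * gt s)) = d%:R] }.

Definition kernel_mass {R : realType} {d : nat} (Omega : set 'rV[R]_d)
    (delta : R) (gam : 'rV[R]_d -> 'rV[R]_d -> R) : \bar R :=
  ereal_sup [set (\int[lebesgue_rV]_(y in eball x delta `&`
                                           ext_domain Omega delta)
                    (gam x y)%:E)%E | x in ext_domain Omega delta].

Definition nonlocal_op {R : realType} {d : nat}
    (gam : 'rV[R]_d -> 'rV[R]_d -> R) (u : 'rV[R]_d -> R) (x : 'rV[R]_d) : R :=
  2 * \int[lebesgue_rV]_y ((u y - u x) * gam x y).

(* Pointwise solution in L^1: the integral defining the operator converges
   absolutely at every point of Omega. For x in Omega the integrand vanishes off
   ext_domain Omega delta, so the values of u elsewhere are irrelevant. *)
Definition nonlocal_solution {R : realType} {d : nat} (Omega : set 'rV[R]_d)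
    (delta : R) (gam : 'rV[R]_d -> 'rV[R]_d -> R) (f g u : 'rV[R]_d -> R) :
    Prop :=
  [/\ lebesgue_rV.-integrable (ext_domain Omega delta) (EFin \o u),
      forall x, Omega x ->
        lebesgue_rV.-integrable setT (fun y => ((u y - u x) * gam x y)%:E),
      forall x, Omega x -> - nonlocal_op gam u x = f x &
      forall y, collar Omega delta y -> u y = g y].

Definition sup_norm {R : realType} {d : nat} (D : set 'rV[R]_d)
    (f : 'rV[R]_d -> R) : \bar R :=
  ereal_sup [set `|f x|%:E | x in D].

Definition energy_norm {R : realType} {d : nat} (Omega : set 'rV[R]_d)
    (delta : R) (gam : 'rV[R]_d -> 'rV[R]_d -> R) (u : 'rV[R]_d -> R) : \bar R :=
  ((\int[lebesgue_rV]_(x in ext_domain Omega delta)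
      \int[lebesgue_rV]_(y in ext_domain Omega delta)
        ((u y - u x) ^+ 2 * gam x y)%:E) `^ 2^-1)%E.

(* F(delta) = O(delta^p) as delta -> 0+, for an extended-real quantity F. *)
Definition big_O_power {R : realType} (F : R -> \bar R) (p : R) : Prop :=
  exists C : R, \forall delta \near 0^'+, (F delta <= (C * delta `^ p)%:E)%E.

(* Main.v *)
Require Import Defs.
From HB Require Import structures.
From mathcomp Require Import all_boot all_order all_algebra.
From mathcomp Require Import all_classical all_reals all_analysis.
From mathcomp Require Import fingroup perm measurable_realfun ring lra.

(* The error e = u_delta - ut0 satisfies |L_delta e| = O(delta^2) on Omega: the
   kernel is invariant under reflections, which kills the odd Taylor terms and
   the mixed second moments, and polar coordinates turn the normalisation of
   gamma into int z_i^2 gamma = 1; the fourth-order remainder is O(delta^2).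
   As L_delta |x|^2 = 2d, adding a multiple of C - |x|^2 reduces the sup bound to
   a maximum principle.  By symmetry the squared energy is
   -2 int e(x) int (e(y) - e(x)) gamma(x, y) dy dx; Omega contributes
   O(delta^2) O(delta^2) and the collar
   O(delta^(2+mu)) O(delta^2) G(gamma) |collar| = O(delta^(3+mu)), because the
   boundary lies in finitely many hyperplanes, so that |collar| = O(delta). *)

Import Order.TTheory GRing.Theory Num.Theory.
Import numFieldNormedType.Exports.

Set Implicit Arguments.
Unset Strict Implicit.
Unset Printing Implicit Defensive.

Local Open Scope classical_set_scope.
Local Open Scope ring_scope.

(** * Lebesgue measure of affine images *)

(** Uniformity in [delta] comes from fixing the smooth data once: a horizon [delta1] is chosen, the
    fourth derivatives of the extension are bounded on its extended domain, and every smaller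
    horizon works inside it. Quantitatively the kernel enters through two numbers, its mass and its
    second moment. The Taylor remainder is estimated by |z|^4 <= delta^2 |z|^2 and so costs a second
    moment, which is normalised; the size delta^-2 of the mass matters only for the energy on the
    collar, where small volume and small boundary data pay for it. The Omega part of the energy is
    O(delta^4), which is O(delta^(3+mu)) because mu <= 1. As Lebesgue measure is built from iterated
    products, changes of variables are restricted to maps acting on separate coordinates up to a
    permutation. These contain the symmetries of the kernel that the moments call for; the volume of
    a slab is found by packing translates instead of rotating it. *)

Lemma open_measurable_rV (R : realType) n (A : set 'rV[R]_n) :
  open A -> measurable A.
Proof.
move=> oA.
pose F (p : 'rV[rat]_n * 'rV[rat]_n) : set 'rV[R]_n :=
  [set y | forall i,
     `]ratr (p.1 ord0 i), ratr (p.2 ord0 i)[%classic (y ord0 i)].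
have mF p : measurable (F p).
  by apply: (@measurable_rV_box R n (fun i => `]ratr (p.1 ord0 i), ratr (p.2 ord0
      i)[%classic)) => i; exact: measurable_itv.
(* Rational boxes not contained in [A] are replaced by the empty set, so that the union runs over a
   whole countable type. *)
suff -> : A = \bigcup_(p in [set: 'rV[rat]_n * 'rV[rat]_n]) (if `[< F p `<=` A >]
    then F p else set0).
  by apply: countable_bigcupT_measurable => // p; case: ifP.
apply/seteqP; split=> [x Ax|x [p _]]; last by case: ifPn => // /asboolP; exact.
have /nbhs_ballP[e /= e0 xeA] : nbhs x A by apply: open_nbhs_nbhs; split.
have hp i : exists q : rat, (ratr q : R) \in `](x ord0 i - e), x ord0 i[.
  by apply: rat_in_itvoo; rewrite ltrBlDr ltrDl.
have hq i : exists q : rat, (ratr q : R) \in `](x ord0 i), x ord0 i + e[.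
  by apply: rat_in_itvoo; rewrite ltrDl.
pose p := \row_i xchoose (hp i); pose q := \row_i xchoose (hq i).
exists (p, q) => //; case: ifPn => [_ i /=|/asboolP[]].
  rewrite !mxE in_itv/=; have := xchooseP (hp i); have := xchooseP (hq i).
  by rewrite !in_itv/= => /andP[-> _] /andP[_ ->].
move=> y Fy; apply: xeA; split=> // i j; rewrite (ord1 i).
have := Fy j; rewrite /= !mxE in_itv/=.
have := xchooseP (hp j); have := xchooseP (hq j).
rewrite !in_itv/= => /andP[_ h1] /andP[h2 _] /andP[h3 h4].
rewrite /ball/= ltr_norml; apply/andP; split.
  by rewrite ltrBrDl addrC; lra.
by lra.
Qed.

Definition cube {R : realType} n (r : R) : set 'rV[R]_n :=
  [set v | forall i, `](- r), r[%classic (v ord0 i)].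

(** Boxes are stable under intersection and generate the sigma-algebra, and the cubes are boxes of
    finite measure that exhaust the space. *)
Lemma measure_rV_unique (R : realType) n (m1 m2 : {measure set 'rV[R]_n -> \bar R}) :
  (forall A : 'I_n -> set (measurableTypeR R), (forall i, measurable (A i)) ->
    m1 [set v | forall i, A i (v ord0 i)] = m2 [set v | forall i, A i (v ord0 i)]) ->
  (forall k : nat, (m1 (cube k%:R) < +oo)%E) ->
  forall A, measurable A -> m1 A = m2 A.
Proof.
move=> m12 m1oo A mA.
pose box (A : 'I_n -> set (measurableTypeR R)) : set 'rV[R]_n :=
  [set v | forall i, A i (v ord0 i)].
pose G := [set box A | A in [set A | forall i, measurable (A i)]].
apply: (measure_unique G (fun k : nat => cube k%:R)) => //.
- apply/seteqP; split; last first.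
    apply: smallest_sub; first exact: sigma_algebra_measurable.
    by move=> _ [B mB <-]; exact: measurable_rV_box.
  apply: smallest_sub; first exact: smallest_sigma_algebra.
  rewrite -bigcup_seq; apply: bigcup_sub => i _ B [C mC <-].
  apply: sub_sigma_algebra; exists (fun j => if j == i then C else setT).
    by move=> j /=; case: ifP.
  apply/seteqP; split=> v /=; first by move=> /(_ i); rewrite eqxx.
  by move=> [_ Cv] j; case: ifPn => // /eqP ->.
- move=> _ _ [B mB <-] [C mC <-]; exists (fun i => B i `&` C i).
    by move=> i; apply: measurableI; [exact: mB|exact: mC].
  apply/seteqP; split=> v /=; first by move=> h; split=> i; have [] := h i.
  by move=> [h1 h2] i; split.
- by move=> k; exists (fun=> `](- k%:R), k%:R[%classic) => // i; exact: measurable_itv.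
- apply/seteqP; split=> // v _; exists (Num.bound (`|v|)) => // i.
  rewrite /cube/= in_itv/= -ltr_norml; apply: le_lt_trans (archi_boundP (normr_ge0 v)).
  rewrite [leRHS]mx_normrE; exact: (le_bigmax _ (fun ij => `|v ij.1 ij.2|) (ord0, i)).
- by move=> _ [B mB <-]; exact: m12.
Qed.


(** By uniqueness of Lebesgue measure half-open intervals suffice; for negative [a] their preimages
    are closed on the other side, with the same length. *)
Lemma lebesgue_measure_affine (R : realType) (a b : R)
    (A : set (measurableTypeR R)) : a != 0 -> measurable A ->
  (`|a|%:E * lebesgue_measure ((fun x => (a * x + b)%R : measurableTypeR R) @^-1` A))%E =
    lebesgue_measure A.
Proof.
move=> a0 mA.
have mf : measurable_fun setT (fun x => a * x + b : measurableTypeR R).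
  by apply: measurable_funD => //; exact: measurable_funM.
have na : 0 <= `|a| by [].
pose pf := measure_function_pushforward__canonical__measure_function_Measure
    (@lebesgue_measure R) mf.
symmetry; apply: (@lebesgue_measure_unique R (mscale (NngNum na) pf)) => //.
move=> _ [[u v]] _ <-.
change (lebesgue_measure `]u, v]%classic = (`|a|%:E * lebesgue_measure
  ((fun x => (a * x + b)%R : measurableTypeR R) @^-1` `]u, v]%classic))%E).
have [ap|an|a_0] := ltgtP 0 a; last by rewrite a_0 eqxx in a0.
- rewrite (_ : _ @^-1` _ = `](u - b) / a, (v - b) / a]%classic); last first.
    apply/seteqP; split => x /=; rewrite !in_itv/= ltr_pdivrMr// ler_pdivlMr// =>
        /andP[h1 h2]; apply/andP; lra.
  rewrite !lebesgue_measure_itv/= !lte_fin ltr_pM2r ?invr_gt0// ltrD2r.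
  case: ifP => _; last by rewrite mule0.
  rewrite -!EFinD -EFinM; congr (_%:E); rewrite gtr0_norm//; field.
  by rewrite gt_eqF.
- rewrite (_ : _ @^-1` _ = `[(v - b) / a, (u - b) / a[%classic); last first.
    apply/seteqP; split => x /=; rewrite !in_itv/= ler_ndivrMr// ltr_ndivlMr// =>
        /andP[h1 h2]; apply/andP; lra.
  rewrite !lebesgue_measure_itv/= !lte_fin ltr_nM2r ?invr_lt0// ltrD2r.
  case: ifP => _; last by rewrite mule0.
  rewrite -!EFinD -EFinM; congr (_%:E); rewrite ltr0_norm//; field.
  by rewrite lt_eqF.
Qed.

Lemma measurable_cube (R : realType) n (r : R) :
  measurable (cube r : set 'rV[R]_n).
Proof.
by apply: (@measurable_rV_box R n (fun=> `](- r), r[%classic : set R)) => i; exact: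
    measurable_itv.
Qed.

Lemma lebesgue_rV_cube (R : realType) n (r : R) :
  (lebesgue_rV (cube r : set 'rV[R]_n) < +oo)%E.
Proof.
rewrite /cube (@lebesgue_rV_box R n (fun=> `](- r), r[%classic : set R)); last first.
  by move=> i; exact: measurable_itv.
have : (0 <= \prod_(i < n) lebesgue_measure (`](- r), r[%classic : set R)%R < +oo)%E.
  apply: (big_ind (fun x => 0 <= x < +oo)%E) => [|x y|i _]; first by rewrite lee01 ltry.
    move=> /andP[x0 xoo] /andP[y0 yoo]; rewrite mule_ge0//=.
    by rewrite lte_mul_pinfty// ge0_fin_numE.
  rewrite measure_ge0/= lebesgue_measure_itv/=; case: ifP => _; exact: ltry.
by case/andP.
Qed.

Lemma lebesgue_rV_lty (R : realType) n (r : R) (A : set 'rV[R]_n) :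
  measurable A -> A `<=` cube r -> (lebesgue_rV A < +oo)%E.
Proof.
move=> mA Ar; apply: le_lt_trans (lebesgue_rV_cube n r); apply: le_measure => //.
  exact: mem_set.
exact: (mem_set (measurable_cube r)).
Qed.

Section affine.
Context {R : realType} (n : nat).
Variables (s : {perm 'I_n}) (a b : 'I_n -> R).

(** Translations, dilations, reflections and permutations of coordinates in one family. Preimages of
    boxes are boxes, so the change of variables reduces to dimension one. *)
Definition affine_coord (z : 'rV[R]_n) : 'rV[R]_n :=
  \row_i (a i * z ord0 (s i) + b i).

Lemma measurable_affine_coord : measurable_fun setT affine_coord.
Proof.
apply: measurable_fun_rVP => i.
rewrite (_ : (fun _ => _) = fun z : 'rV[R]_n => a i * z ord0 (s i) + b i); last first.
  by apply/funext => z; rewrite mxE.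
apply: measurable_funD => //; apply: measurable_funM => //.
exact: measurable_coord.
Qed.

Hypothesis a0 : forall i, a i != 0.

(** Both sides are measures in [A]. On a box the factor [a i] is absorbed by scaling the side with
    index [s i], whence the reindexing of the product along [s]. *)
Lemma lebesgue_rV_affine (A : set 'rV[R]_n) : measurable A ->
  ((\prod_i `|a i|)%:E * lebesgue_rV (affine_coord @^-1` A))%E = lebesgue_rV A.
Proof.
move=> mA.
have na : 0 <= \prod_i `|a i| by exact: prodr_ge0.
pose pf := measure_function_pushforward__canonical__measure_function_Measure
    (@lebesgue_rV R n) measurable_affine_coord.
symmetry; apply: (@measure_rV_unique R n (@lebesgue_rV R n) (mscale (NngNum na) pf))
    => //.
  move=> B mB.
  change (lebesgue_rV [set v : 'rV[R]_n | forall i, B i (v ord0 i)] = (\prod_i `|a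
      i|)%:E *
    lebesgue_rV (affine_coord @^-1` [set v : 'rV[R]_n | forall i, B i (v ord0 i)]))%E.
  rewrite lebesgue_rV_box// (_ : _ @^-1` _ = [set v : 'rV[R]_n | forall j,
    ((fun x => (a (s^-1 j)%g * x + b (s^-1 j)%g)%R : measurableTypeR R) @^-1` B (s^-1
        j)%g) (v ord0 j)]).
    rewrite (@lebesgue_rV_box R n (fun j => (fun x => (a (s^-1 j)%g * x + b (s^-1
        j)%g)%R : measurableTypeR R) @^-1` B (s^-1 j)%g)); last first.
      move=> j; rewrite -[X in measurable X]setTI.
      have : measurable_fun setT (fun x => a (s^-1 j)%g * x + b (s^-1 j)%g :
          measurableTypeR R).
        by apply: measurable_funD => //; exact: measurable_funM.
      by move=> h; exact: (h measurableT _ (mB (s^-1 j)%g)).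
    rewrite -prodEFin [X in (_ * X)%E](reindex_inj (@perm_inj _ s))/= -big_split/=.
    by apply: eq_bigr => i _; rewrite permK lebesgue_measure_affine.
  apply/seteqP; split => v /= h i; last by have := h (s i); rewrite mxE permK.
  by have := h (s^-1 i)%g; rewrite mxE permKV.
by move=> k; exact: lebesgue_rV_cube.
Qed.
End affine.

(** * Polar coordinates *)

Section density.
Local Open Scope ereal_scope.
Context d (T : measurableType d) (R : realType).
Variables (m1 m2 : {measure set T -> \bar R}) (g : T -> R).
Hypotheses (mg : measurable_fun setT g) (g0 : forall x, (0 <= g x)%R).
Hypothesis m12 : forall A, measurable A -> m1 A = \int[m2]_(x in A) (g x)%:E.

Import HBNNSimple.

Let density_indic A : measurable A ->
  \int[m1]_x (\1_A x)%:E = \int[m2]_x ((\1_A x)%:E * (g x)%:E).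
Proof.
move=> mA; rewrite integral_indic// setIT m12// integral_mkcond.
apply: eq_integral => x _; rewrite patchE indicE.
by case: (x \in A); rewrite ?mul1e ?mul0e.
Qed.

(** The hypothesis on sets is the case of indicators; linearity gives simple functions and monotone
    convergence the rest. *)
Lemma ge0_integral_density (f : T -> \bar R) : measurable_fun setT f ->
  (forall x, 0 <= f x) -> \int[m1]_x f x = \int[m2]_x (f x * (g x)%:E).
Proof.
move=> mf f0; pose f_ := nnsfun_approx measurableT mf.
have fE x : f x = limn (fun n => (f_ n x)%:E).
  by apply/esym/cvg_lim => //; exact: cvg_nnsfun_approx.
have mfn n : measurable_fun setT (f_ n) by exact: measurable_funP.
have fgE x : f x * (g x)%:E = limn (fun n => (f_ n x)%:E * (g x)%:E).
  apply/esym/cvg_lim => //; apply: cvgeZr => //.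
  exact: (@cvg_nnsfun_approx _ _ _ _ _ _ _ (fun x _ => f0 x)).
transitivity (limn (fun n => \int[m1]_x (f_ n x)%:E)).
  under eq_integral do rewrite fE.
  rewrite -monotone_convergence//.
  - by move=> n; exact/measurable_EFinP.
  - by move=> n x _; rewrite lee_fin.
  - by move=> x _ m n mn; rewrite lee_fin; exact/lefP/nd_nnsfun_approx.
under [RHS]eq_integral do rewrite fgE.
rewrite [RHS]monotone_convergence//; last 3 first.
- by move=> n; apply: emeasurable_funM; exact/measurable_EFinP.
- by move=> n x _; rewrite mule_ge0// lee_fin.
- move=> x _ m n mn; rewrite lee_wpmul2r ?lee_fin//; exact/lefP/nd_nnsfun_approx.
congr (limn _); apply/funext => n.
under eq_integral do rewrite fimfunE -fsumEFin//.
rewrite ge0_integral_fsum//; last 2 first.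
- by move=> r; exact/measurable_EFinP/measurable_funM.
- by move=> r x _; rewrite nnfun_muleindic_ge0.
transitivity (\int[m2]_x \sum_(r \in range (f_ n))
    ((r * \1_(f_ n @^-1` [set r]) x)%:E * (g x)%:E)); last first.
  apply: eq_integral => x _; rewrite fimfunE -fsumEFin// ge0_mule_fsuml//.
  by move=> r; rewrite nnfun_muleindic_ge0.
rewrite [RHS]ge0_integral_fsum//; last 2 first.
- by move=> r; apply: emeasurable_funM; apply/measurable_EFinP => //; exact:
    measurable_funM.
- by move=> r x _; rewrite mule_ge0 ?nnfun_muleindic_ge0// lee_fin.
apply: eq_fsbigr => r _; rewrite integralZl_indic_nnsfun// density_indic//.
have [r0|r0] := leP 0%R r.
  rewrite -ge0_integralZl_EFin//.
  - by apply: eq_integral => x _; rewrite EFinM muleA.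
  - by move=> x _; rewrite mule_ge0 ?lee_fin.
  - by apply: emeasurable_funM; exact/measurable_EFinP.
(* A nonnegative simple function has no negative value, so this level set is empty and both
   integrals vanish. *)
rewrite preimage_nnfun0// integral0_eq; last by move=> x _; rewrite indicE in_set0 mul0e.
rewrite mule0 integral0_eq// => x _; by rewrite indicE in_set0 mulr0 mul0e.
Qed.

End density.

(** * Invariance of the integral under coordinate isometries *)

Section affine_invariance.
Local Open Scope ereal_scope.
Context {R : realType} (n : nat).
Variables (s : {perm 'I_n}) (a b : 'I_n -> R).
Hypothesis a1 : forall i, `|a i|%R = 1%R.

Lemma lebesgue_rV_isometry (A : set 'rV[R]_n) : measurable A ->
  lebesgue_rV (affine_coord s a b @^-1` A) = lebesgue_rV A.
Proof.
move=> mA; rewrite -[RHS](@lebesgue_rV_affine R n s a b)//; last first.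
  by move=> i; rewrite -normr_gt0 a1.
by rewrite big1 ?mul1e.
Qed.

Lemma ge0_integral_isometry (f : 'rV[R]_n -> \bar R) :
  measurable_fun setT f -> (forall x, 0 <= f x) ->
  \int[lebesgue_rV]_x f (affine_coord s a b x) = \int[lebesgue_rV]_x f x.
Proof.
move=> mf f0.
have := @ge0_integral_pushforward _ _ _ _ R _ (measurable_affine_coord s a b)
  (@lebesgue_rV R n) setT f measurableT mf (fun x _ => f0 x).
rewrite preimage_setT => <-.
apply: eq_measure_integral => [|? A mA _]; first exact: measurable_affine_coord.
exact: lebesgue_rV_isometry.
Qed.

Lemma integral_isometry (f : 'rV[R]_n -> \bar R) : measurable_fun setT f ->
  \int[lebesgue_rV]_x f (affine_coord s a b x) = \int[lebesgue_rV]_x f x.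
Proof.
move=> mf; rewrite integralE [RHS]integralE.
rewrite -(ge0_integral_isometry (measurable_funepos mf))//.
rewrite -(ge0_integral_isometry (measurable_funeneg mf))//.
rewrite -[fun x => f _]/(f \o affine_coord s a b) funepos_comp funeneg_comp.
by [].
Qed.

Lemma integrable_isometry (f : 'rV[R]_n -> \bar R) :
  lebesgue_rV.-integrable setT f ->
  lebesgue_rV.-integrable setT (fun x => f (affine_coord s a b x)).
Proof.
move=> /integrableP[mf foo]; apply/integrableP; split.
  by apply: (measurableT_comp mf); exact: measurable_affine_coord.
rewrite (ge0_integral_isometry (f := fun x => `|f x|))//.
exact: measurableT_comp.
Qed.

End affine_invariance.

Section translation_reflection.
Local Open Scope ereal_scope.
Context {R : realType} (n : nat).
Implicit Types (f : 'rV[R]_n -> \bar R) (c : 'rV[R]_n).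

Let translateE c : affine_coord 1%g (fun=> 1%R) (c ord0) = (fun x => x + c)%R.
Proof.
by apply/funext => x; apply/rowP => i; rewrite !mxE perm1 mul1r.
Qed.

Let reflectE c : affine_coord 1%g (fun=> -1)%R (c ord0) = (fun x => c - x)%R.
Proof.
by apply/funext => x; apply/rowP => i; rewrite !mxE perm1 mulN1r addrC.
Qed.

Let norm1 (i : 'I_n) : `|1%R : R|%R = 1%R. Proof. exact: normr1. Qed.
Let normN1 (i : 'I_n) : `|-1%R : R|%R = 1%R. Proof. exact: normrN1. Qed.

Lemma lebesgue_rV_translate c (A : set 'rV[R]_n) : measurable A ->
  lebesgue_rV [set x | A (x + c)%R] = lebesgue_rV A.
Proof.
by move=> /(@lebesgue_rV_isometry R n 1%g _ (c ord0) norm1); rewrite translateE.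
Qed.

Lemma integral_translate c f : measurable_fun setT f ->
  \int[lebesgue_rV]_x f (x + c)%R = \int[lebesgue_rV]_x f x.
Proof.
move=> mf; rewrite -(integral_isometry 1%g (c ord0) norm1 mf).
by rewrite translateE.
Qed.

Lemma integral_reflect c f : measurable_fun setT f ->
  \int[lebesgue_rV]_x f (c - x)%R = \int[lebesgue_rV]_x f x.
Proof.
move=> mf; rewrite -(integral_isometry 1%g (c ord0) normN1 mf).
by rewrite reflectE.
Qed.

Lemma integrable_translate c f : lebesgue_rV.-integrable setT f ->
  lebesgue_rV.-integrable setT (fun x => f (x + c)%R).
Proof.
by move=> /(integrable_isometry 1%g (c ord0) norm1); rewrite translateE.
Qed.

Lemma integrable_reflect c f : lebesgue_rV.-integrable setT f ->
  lebesgue_rV.-integrable setT (fun x => f (c - x)%R).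
Proof.
by move=> /(integrable_isometry 1%g (c ord0) normN1); rewrite reflectE.
Qed.

End translation_reflection.

Section enorm.
Context {R : realType} (n : nat).
Implicit Types z : 'rV[R]_n.

Lemma enormE z : enorm z = Num.sqrt (\sum_i z ord0 i ^+ 2).
Proof. by congr Num.sqrt; apply: eq_bigr => i _; rewrite expr2. Qed.

Lemma enorm_ge0 z : 0 <= enorm z.
Proof. exact: sqrtr_ge0. Qed.

Lemma sqr_enorm z : enorm z ^+ 2 = \sum_i z ord0 i ^+ 2.
Proof. by rewrite enormE sqr_sqrtr// sumr_ge0// => i _; rewrite sqr_ge0. Qed.

Lemma enormZ (r : R) z : enorm (r *: z) = `|r| * enorm z.
Proof.
rewrite !enormE -sqrtr_sqr -sqrtrM ?sqr_ge0// mulr_sumr.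
by congr Num.sqrt; apply: eq_bigr => i _; rewrite mxE exprMn.
Qed.

Lemma enormN z : enorm (- z) = enorm z.
Proof. by rewrite -scaleN1r enormZ normrN1 mul1r. Qed.

Lemma enorm0 : enorm (0 : 'rV[R]_n) = 0.
Proof. by rewrite -(scale0r (0 : 'rV[R]_n)) enormZ normr0 mul0r. Qed.

Lemma enorm_coord z i : `|z ord0 i| <= enorm z.
Proof.
rewrite enormE -sqrtr_sqr ler_sqrt; last first.
  by rewrite sumr_ge0// => j _; rewrite sqr_ge0.
by rewrite (bigD1 i)//= lerDl sumr_ge0// => j _; rewrite sqr_ge0.
Qed.

Lemma enorm_eq0 z : enorm z = 0 -> z = 0.
Proof.
move=> z0; apply/rowP => i; rewrite mxE; apply/eqP.
by rewrite -normr_le0 -z0; exact: enorm_coord.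
Qed.

Lemma measurable_enorm : measurable_fun setT (@enorm R n).
Proof.
apply: (@measurableT_comp _ _ _ _ _ _ (fun x : measurableTypeR R => Num.sqrt x :
    measurableTypeR R)).
  by apply: continuous_measurable_fun; exact: sqrt_continuous.
apply: measurable_sum => i.
by apply: measurable_funM; exact: measurable_coord.
Qed.

Lemma enorm_continuous : continuous (@enorm R n).
Proof.
move=> z; apply: (@continuous_comp _ _ _ (fun z : 'rV[R]_n => dotrV z z) Num.sqrt).
  move: z; apply: continuous_big => [|i _ z]; first exact: add_continuous.
  have c : {for z, continuous (fun v : 'rV[R]_n => v ord0 i)} by exact: coord_continuous.
  exact: (cvgM c c).
exact: sqrt_continuous.
Qed.

Lemma dotrV_continuous (a : 'rV[R]_n) : continuous (dotrV a).
Proof.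
apply: continuous_big => [|i _ z]; first exact: add_continuous.
have c : {for z, continuous (fun v : 'rV[R]_n => v ord0 i)} by exact: coord_continuous.
exact: (cvgM (cvg_cst _) c).
Qed.

End enorm.

Section polar.
Context {R : realType} (n : nat).
Local Notation d := n.+1.

Definition shell (A : set R) : set 'rV[R]_d := (@enorm R d) @^-1` A.

Lemma measurable_shell (A : set (measurableTypeR R)) :
  measurable A -> measurable (shell A).
Proof.
by move=> mA; rewrite -[X in measurable X]setTI; exact: (@measurable_enorm R d
    measurableT A mA).
Qed.

Lemma lebesgue_rV_set1 (z : 'rV[R]_d) : lebesgue_rV [set z] = 0%E.
Proof.
rewrite (_ : [set z] = [set v | forall i, [set z ord0 i] (v ord0 i)]); last first.
  apply/seteqP; split=> v /=; first by move=> ->.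
  by move=> vz; apply/rowP => i; exact: vz.
rewrite (@lebesgue_rV_box R d (fun i => [set z ord0 i])); last first.
  by move=> i; exact: measurable_set1.
by rewrite big_ord_recl lebesgue_measure_set1 mul0e.
Qed.

(** The shell is the origin alone. This allows radii to be restricted to positive ones, where
    [radial_density] is supported. *)
Lemma shell0 : lebesgue_rV (shell `]-oo, 0%R]) = 0%E.
Proof.
rewrite -(lebesgue_rV_set1 0); congr lebesgue_rV; apply/seteqP; split => z /=.
  by rewrite /shell/= in_itv/= => z0; apply: enorm_eq0; apply/eqP; rewrite eq_le z0
      enorm_ge0.
by move=> ->; rewrite /shell/= enorm0 in_itv/=.
Qed.

Lemma shell_fin (a b : R) : (lebesgue_rV (shell `]a, b]) < +oo)%E.
Proof.
apply: le_lt_trans (lebesgue_rV_cube d (`|b| + 1)).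
apply: le_measure.
- have h : measurable (shell `]a, b]) by exact: (measurable_shell (measurable_itv _)).
  exact: mem_set h.
- exact: (mem_set (@measurable_cube R d _)).
move=> z; rewrite /shell/cube/= in_itv/= => /andP[_ zb] i.
rewrite in_itv/= -ltr_norml (le_lt_trans (enorm_coord z i))//.
by rewrite (le_lt_trans zb)// (le_lt_trans (ler_norm b))// ltrDl.
Qed.

(* The origin is left out, as in [sphere_measure], where the radius ranges over
   ]0, 1]. *)
Definition unit_ball_volume : R := fine (lebesgue_rV (shell `]0, 1])).

Local Notation V := unit_ball_volume.

(** Dilation by [r] carries the punctured unit ball onto this shell and has Jacobian r^d. *)
Lemma shell_scale (r : R) : 0 < r ->
  lebesgue_rV (shell `]0, r]) = (r ^+ d * V)%:E.
Proof.
move=> r0.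
have mS : measurable (shell `]0, r]) by exact: (measurable_shell (measurable_itv _)).
rewrite -(@lebesgue_rV_affine R d 1%g (fun=> r) (fun=> 0) (fun=> lt0r_neq0 r0) _ mS).
rewrite prodr_const card_ord gtr0_norm// EFinM /unit_ball_volume fineK; last first.
  by rewrite ge0_fin_numE ?measure_ge0// shell_fin.
congr (_ * lebesgue_rV _)%E.
have TE z : affine_coord 1%g (fun=> r) (fun=> 0) z = r *: z.
  by apply/rowP => i; rewrite !mxE perm1 addr0.
apply/seteqP; split => z /=; rewrite /shell/= TE enormZ gtr0_norm// !in_itv/=.
  by rewrite pmulr_rgt0// -[X in _ <= X]mulr1 ler_pM2l.
by rewrite pmulr_rgt0// -[X in _ -> is_true (_ && (_ <= X))]mulr1 ler_pM2l.
Qed.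

Lemma shell_oc (a b : R) : 0 <= a -> a <= b ->
  lebesgue_rV (shell `]a, b]) = (V * (b ^+ d - a ^+ d))%:E.
Proof.
move=> a0 ab.
have [a00|ap] := eqVneq a 0.
  rewrite a00 expr0n/= subr0 mulrC; have [b0|bp] := eqVneq b 0; last first.
    by rewrite shell_scale// lt_neqAle eq_sym bp (le_trans a0).
  rewrite b0 (_ : shell _ = set0) ?measure0 ?expr0n ?mul0r//.
  by apply/seteqP; split=> z //; rewrite /shell/= in_itv/= => /andP[/lt_le_trans h
      /h]; rewrite ltxx.
have {}a0 : 0 < a by rewrite lt_neqAle eq_sym ap.
rewrite (_ : shell _ = shell `]0, b] `\` shell `]0, a]).
  transitivity (lebesgue_rV (shell `]0, b]%classic%R) -
      lebesgue_rV (shell `]0, b]%classic%R `&` shell `]0, a]%classic%R))%E.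
    apply: measureD; last exact: shell_fin.
    - exact: (measurable_shell (measurable_itv _)).
    - exact: (measurable_shell (measurable_itv _)).
  rewrite (_ : _ `&` _ = shell `]0, a]).
    rewrite !shell_scale// ?(lt_le_trans a0)// -EFinB; congr (_%:E); ring.
  apply/seteqP; split=> z; first by case.
  rewrite /shell/= => h; split=> //; move: h; rewrite !in_itv/= => /andP[-> h].
  exact: le_trans ab.
apply/seteqP; split=> z; rewrite /shell/= !in_itv/=.
  move=> /andP[h1 h2]; split; first by rewrite h2 (lt_trans a0).
  by apply/negP; rewrite negb_and -!ltNge h1 orbT.
by move=> [/andP[z0 ->]] /negP; rewrite z0/= -ltNge => ->.
Qed.

(** The derivative of s |-> V s^d on positive radii, that is, the area of the sphere of radius s;
    extended by 0 it is a density on the whole line. *)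
Definition radial_density (s : R) : R := if 0 < s then V * d%:R * s ^+ n else 0.

Lemma measurable_radial_density : measurable_fun setT radial_density.
Proof.
apply: measurable_fun_ifT => //.
  by apply: measurable_fun_ltr => //.
by apply: measurable_funM => //; exact: measurable_funX.
Qed.

Lemma radial_density_ge0 s : 0 <= radial_density s.
Proof.
rewrite /radial_density; case: ifP => // s0.
by rewrite !mulr_ge0 ?exprn_ge0 ?fine_ge0 ?measure_ge0 // ltW.
Qed.

Lemma integral_radial_density_oc (a b : R) : 0 <= a -> a < b ->
  (\int[lebesgue_measure]_(s in `]a, b]) (radial_density s)%:E)%E =
  (V * (b ^+ d - a ^+ d))%:E.
Proof.
move=> a0 ab.
transitivity (\int[lebesgue_measure]_(s in `]a, b]) (V * d%:R * s ^+ n)%:E)%E.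
  apply: eq_integral => s /set_mem/=; rewrite in_itv/= => /andP[as_ _].
  by rewrite /radial_density (le_lt_trans a0).
have cf : continuous (fun s : R => V * d%:R * s ^+ n).
  by move=> s; apply: cvgM; [exact: cvg_cst|exact: exprn_continuous].
have D (s : R) : is_derive s 1 (fun s : R => V * s ^+ d) (V * d%:R * s ^+ n).
  have h := DeriveDef (@exprn_derivable R d s 1) (exp_derive d s 1).
  have h2 := is_deriveZ V h.
  rewrite (_ : V * _ * _ = V *: (d%:R *: s ^+ d.-1 *: 1)); first exact: h2.
  by rewrite /GRing.scale/= mulr1 mulrA.
have cF : continuous (fun s : R => V * s ^+ d).
  by move=> s; apply: cvgM; [exact: cvg_cst|exact: exprn_continuous].
rewrite integral_itv_obnd_cbnd; last first.
  apply/measurable_EFinP/measurable_funTS.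
  by apply: continuous_measurable_fun.
rewrite (@continuous_FTC2 R _ (fun s => V * s ^+ d) a b ab)//.
- by rewrite -EFinB; congr (_%:E); ring.
- by apply: continuous_subspaceT.
- split.
  + by move=> s _; have [] := D s.
  + by apply: cvg_at_right_filter; exact: cF.
  + by apply: cvg_at_left_filter; exact: cF.
- by move=> s _; rewrite derive1E; have [_ ->] := D s.
Qed.

End polar.

Section polar2.
Context {R : realType} (n : nat).
Local Notation d := n.+1.

Definition radial_measure (A : set (measurableTypeR R)) : \bar R :=
  (\int[lebesgue_measure]_(s in A) (radial_density n s)%:E)%E.

Let radial_measure0 : radial_measure set0 = 0%E.
Proof. exact: integral_set0. Qed.

Let radial_measure_ge0 A : (0 <= radial_measure A)%E.
Proof. by apply: integral_ge0 => s _; rewrite lee_fin radial_density_ge0. Qed.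

Let radial_measure_sigma_additive : semi_sigma_additive radial_measure.
Proof.
apply: semi_sigma_additive_nng_induced.
  by apply/measurable_EFinP; exact: measurable_radial_density.
by move=> s; rewrite lee_fin radial_density_ge0.
Qed.

HB.instance Definition _ := isMeasure.Build _ _ _ radial_measure
  radial_measure0 radial_measure_ge0 radial_measure_sigma_additive.

Lemma lebesgue_rV_shellI (A : set (measurableTypeR R)) : measurable A ->
  lebesgue_rV (shell (n := n) A) = lebesgue_rV (shell (n := n) (A `&` `](0 : R), +oo[)).
Proof.
move=> mA; have mI : measurable (A `&` `](0 : R), +oo[) by apply: measurableI => //;
    exact: measurable_itv.
have mS0 : measurable (shell (n := n) `]-oo, (0 : R)]).
  exact: (measurable_shell (measurable_itv _)).
apply/eqP; rewrite eq_le; apply/andP; split; last first.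
  apply: le_measure; [exact: (mem_set (measurable_shell mI))|exact: (mem_set
      (measurable_shell mA))|].
  by move=> z [].
rewrite -[leRHS]adde0 -(shell0 (R := R) n).
apply: le_trans (measureU2 _ (measurable_shell mI) mS0).
apply: le_measure.
- exact: (mem_set (measurable_shell mA)).
- exact: (mem_set (measurableU _ _ (measurable_shell mI) mS0)).
move=> z Az; case: (ltP 0 (enorm z)) => z0; [left|right].
  by split => //=; rewrite in_itv/= andbT.
by rewrite /shell/= in_itv.
Qed.

Lemma radial_measureI (A : set (measurableTypeR R)) : measurable A ->
  radial_measure A = radial_measure (A `&` `](0 : R), +oo[).
Proof.
move=> mA; rewrite /radial_measure integral_mkcond [RHS]integral_mkcond.
apply: eq_integral => s _; rewrite !patchE in_setI.
case: (s \in A) => //=; rewrite /radial_density.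
case: ifPn => [s0|]; first by rewrite mem_set//= in_itv/= s0.
by case: ifP.
Qed.

(** Both sides are measures in [A], and on half-open intervals they agree by the fundamental theorem
    of calculus. Such an interval may reach below 0, hence its truncation at [Num.max a 0]. *)
Lemma lebesgue_rV_shell (A : set (measurableTypeR R)) : measurable A ->
  lebesgue_rV (shell (n := n) A) = radial_measure A.
Proof.
have me : measurable_fun setT (fun z : 'rV[R]_d => enorm z : measurableTypeR R).
  exact: measurable_enorm.
pose m1 := measure_function_pushforward__canonical__measure_function_Measure
    (@lebesgue_rV R d) me.
pose G : set (set R) := @ocitv R.
apply: (@measure_unique _ R (measurableTypeR R) G (fun k : nat => `](- k%:R : R),
    k%:R]%classic) _ _ _ _ m1 radial_measure).
- by [].
- exact: ocitvI.
- by move=> k; exists (- k%:R, k%:R).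
- apply/seteqP; split => // x _; exists (Num.bound (`|x|)) => //=.
  rewrite /= in_itv/=; have := archi_boundP (normr_ge0 x).
  by rewrite ltr_norml => /andP[-> /ltW ->].
- move=> _ [[a b] _ <-]/=.
  change (lebesgue_rV (shell (n := n) `]a, b]) = radial_measure `]a, b]).
  rewrite lebesgue_rV_shellI// radial_measureI//.
  rewrite (_ : `]a, b]%classic `&` `]0, +oo[%classic = `](Num.max a 0), b]%classic);
      last first.
    apply/seteqP; split => s /=; rewrite !in_itv/= gt_max andbT.
      by move=> [/andP[-> ->] ->].
    by move=> /andP[/andP[-> ->] ->].
  have m0 : 0 <= Num.max a 0 by rewrite le_max lexx orbT.
  have [ab|ba] := ltP (Num.max a 0) b.
    rewrite shell_oc//; last exact: ltW.
    exact: (esym (integral_radial_density_oc n m0 ab)).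
  by rewrite set_itv_ge ?measure0// -leNgt bnd_simp.
- by move=> k; exact: shell_fin.
Qed.

(** Only radial integrands occur, so polar coordinates reduce to the law of [enorm]: the
    push-forward of Lebesgue measure along it has density [radial_density]. *)
Theorem ge0_integral_radial (f : measurableTypeR R -> \bar R) :
  measurable_fun setT f -> (forall s, 0 <= f s)%E ->
  (\int[lebesgue_rV]_z f (enorm (z : 'rV[R]_d)) =
   \int[lebesgue_measure]_s (f s * (radial_density n s)%:E))%E.
Proof.
move=> mf f0.
have me : measurable_fun setT (fun z : 'rV[R]_d => enorm z : measurableTypeR R).
  exact: measurable_enorm.
have := @ge0_integral_pushforward _ _ _ _ R _ me
  (@lebesgue_rV R d) setT f measurableT mf (fun x _ => f0 x).
rewrite preimage_setT => <-.
apply: (@ge0_integral_density _ (measurableTypeR R)) => //.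
- exact: measurable_radial_density.
- exact: radial_density_ge0.
- by move=> A mA; exact: lebesgue_rV_shell.
Qed.

(** The segments ]0, 1] w over unit vectors w fill the punctured unit ball, since z is |z| times z /
    |z|. *)
Lemma sphere_areaE : sphere_area R d = d%:R * unit_ball_volume n.
Proof.
rewrite /sphere_area /sphere_measure /unit_ball_volume.
rewrite (_ : [set _ | _ in _ & _ in _] = shell `]0, 1]%classic).
  rewrite fineM// ge0_fin_numE ?measure_ge0//; exact: shell_fin.
apply/seteqP; split => z.
  move=> [r /=]; rewrite in_itv/= => /andP[r0 r1] [w w1 <-].
  by rewrite /shell/= in_itv/= enormZ w1 mulr1 gtr0_norm// r0.
rewrite /shell/= in_itv/= => /andP[z0 z1]; exists (enorm z); first by rewrite /=
    in_itv/= z0.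
exists ((enorm z)^-1 *: z); last by rewrite scalerA divff ?scale1r// gt_eqF.
by rewrite /= enormZ gtr0_norm ?invr_gt0// mulVf// gt_eqF.
Qed.

End polar2.

(** * Moments of the kernel *)

Section kernel.
Context {R : realType} (d : nat) (delta : R) (gam : 'rV[R]_d -> 'rV[R]_d -> R).
Hypothesis kgam : kernel_conditions delta gam.

Lemma kernel_translate x y : gam x y = gam 0 (y - x).
Proof.
have [gt [gtE _ _ _]] := kernel_radial kgam.
by rewrite !gtE subr0.
Qed.

Lemma kernel_enorm z z' : enorm z = enorm z' -> gam 0 z = gam 0 z'.
Proof.
have [gt [gtE _ _ _]] := kernel_radial kgam.
by rewrite !gtE !subr0 => ->.
Qed.

Lemma kernel_eq0 z : delta <= enorm z -> gam 0 z = 0.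
Proof.
move=> dz; apply: (kernel_support kgam); rewrite /eball/= subr0.
by apply/negP; rewrite -leNgt.
Qed.

Lemma kernel_measurable : measurable_fun setT (gam 0).
Proof.
have [gt [gtE _ /integrableP[mgt _] _]] := kernel_radial kgam.
(* The profile is known to be measurable on ]0, delta[ only. [h] keeps its value at 0, which is that
   of the kernel at the origin, and vanishes beyond the support. *)
pose h (s : measurableTypeR R) : measurableTypeR R :=
  if s <= 0 then gt 0 else (gt \_ `]0, delta[) s.
have -> : gam 0 = h \o (fun z : 'rV[R]_d => enorm z : measurableTypeR R).
  apply/funext => z; rewrite /h/= patchE.
  have [z0|z0] := leP (enorm z) 0.
    by rewrite gtE subr0; congr gt; apply/eqP; rewrite eq_le z0 enorm_ge0.
  case: ifPn => [|/negP zd]; first by rewrite gtE subr0.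
  rewrite kernel_eq0// leNgt; apply/negP => zd'; apply: zd.
  by apply/mem_set; rewrite /= in_itv/= z0.
apply: measurableT_comp; last exact: measurable_enorm.
apply: measurable_fun_ifT => //.
  by apply: measurable_fun_ler => //.
apply/(measurable_restrictT _ _).1; first exact: measurable_itv.
exact/measurable_EFinP.
Qed.

End kernel.

(** In polar coordinates the integrand is w_d s^2 s^n gt(s), whose power n + 2 is the d + 1 of the
    normalisation; the factor s^2 makes the uncontrolled value [gt 0] harmless. *)
Lemma kernel_second_moment_enorm (R : realType) (n : nat) (delta : R)
    (g : 'rV[R]_n.+1 -> 'rV[R]_n.+1 -> R) : kernel_conditions delta g ->
  (\int[lebesgue_rV]_z (enorm z ^+ 2 * g 0 z)%:E = n.+1%:R%:E)%E.
Proof.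
move=> kg; have [gt [gtE gt0 igt gtd]] := kernel_radial kg.
have [mgt _] := integrableP _ _ _ igt.
pose D : set R := `]0, delta[%classic.
have mD : measurable (D : set (measurableTypeR R)) by exact: measurable_itv.
pose f (s : measurableTypeR R) : R := ((fun s => s ^+ 2 * gt s) \_ D) s.
have mf : measurable_fun setT f.
  apply/(measurable_restrictT _ _).1 => //.
  apply: measurable_funM; last exact/measurable_EFinP.
  exact: measurable_funX.
have f0 s : 0 <= f s.
  rewrite /f patchE; case: ifPn => // /set_mem; rewrite /D/= in_itv/= => h.
  by rewrite mulr_ge0 ?sqr_ge0// ltW// gt0.
transitivity (\int[lebesgue_rV]_(z in [set: 'rV[R]_n.+1]) (f (enorm z))%:E)%E.
  apply: eq_integral => z _; congr EFin; rewrite /f patchE.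
  case: ifPn => [|/negP zd]; first by rewrite gtE subr0.
  have [z0|z0] := leP (enorm z) 0.
    by rewrite (_ : enorm z = 0) ?expr0n ?mul0r//; apply/eqP; rewrite eq_le z0 enorm_ge0.
  rewrite (kernel_eq0 kg) ?mulr0// leNgt; apply/negP => zd'; apply: zd.
  by apply/mem_set; rewrite /D/= in_itv/= z0.
rewrite (@ge0_integral_radial R n (EFin \o f))//; last exact/measurable_EFinP.
pose c : R := n.+1%:R * unit_ball_volume n.
have c0 : 0 <= c by rewrite mulr_ge0 ?ler0n ?fine_ge0 ?measure_ge0.
have mh : measurable_fun D (fun s : R => s ^+ n.+2 * gt s).
  apply: measurable_funM; last exact/measurable_EFinP.
  exact: measurable_funX.
(* The normalisation is an equation between reals, in which a divergent integral would be read as 0;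
   integrability turns it into an equation between extended reals. *)
have ih : lebesgue_measure.-integrable D (EFin \o (fun s => s ^+ n.+2 * gt s)).
  have := @integrableMr _ _ R lebesgue_measure D mD (fun s => s ^+ n.+2) _ _ _ igt.
  apply.
    exact: measurable_funX.
  exists (delta ^+ n.+2); split; first exact: num_real.
  move=> M dM s; rewrite /D/= in_itv/= => /andP[s0 sd].
  rewrite normrX (ger0_norm (ltW s0)) (le_trans _ (ltW dM))//.
  by apply: lerXn2r; rewrite ?nnegrE; apply: ltW => //; exact: lt_trans sd.
transitivity (\int[lebesgue_measure]_(s in D) (c%:E * (s ^+ n.+2 * gt s)%:E))%E.
  rewrite [RHS]integral_mkcond; apply: eq_integral => s _.
  rewrite /= /f !patchE; case: ifPn => [/set_mem|]; last by rewrite mul0e.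
  rewrite /D/= in_itv/= => /andP[s0 sd]; rewrite -!EFinM; congr EFin.
  by rewrite /radial_density s0 /c !exprS; ring.
rewrite ge0_integralZl_EFin//.
- by rewrite -[X in (_ * X)%E]fineK ?integrable_fin_num// -EFinM -gtd sphere_areaE.
- move=> s; rewrite /D/= in_itv/= => /andP[s0 sd].
  by rewrite lee_fin mulr_ge0 ?exprn_ge0 ?ltW// gt0// s0.
- exact/measurable_EFinP.
Qed.

Lemma Rintegral_sum d (T : measurableType d) (R : realType)
    (mu : {measure set T -> \bar R}) (D : set T) (I : Type) (r : seq I)
    (f : I -> T -> R) : measurable D ->
  (forall i, mu.-integrable D (EFin \o f i)) ->
  \int[mu]_(x in D) (\sum_(i <- r) f i x) = \sum_(i <- r) \int[mu]_(x in D) f i x.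
Proof.
move=> mD fi; elim: r => [|i r IH].
  under eq_Rintegral do rewrite big_nil.
  by rewrite big_nil /Rintegral integral0.
under eq_Rintegral do rewrite big_cons.
rewrite RintegralD// ?IH ?big_cons//.
rewrite (_ : _ \o _ = fun x => (\sum_(j <- r) (f j x)%:E)%E); last first.
  by apply/funext => x /=; rewrite sumEFin.
by apply: integrable_sum => // j _; exact: fi.
Qed.

Section moments.
Context {R : realType} (n : nat) (delta : R) (g : 'rV[R]_n.+1 -> 'rV[R]_n.+1 -> R).
Hypothesis kg : kernel_conditions delta g.
Hypothesis g_fin : (\int[lebesgue_rV]_z (g 0 z)%:E < +oo)%E.
Local Notation k := (g 0).
Local Notation d := n.+1.

Lemma integrable_kernel : lebesgue_rV.-integrable setT (EFin \o k).
Proof.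
apply/integrableP; split; first by apply/measurable_EFinP; exact: (kernel_measurable kg).
apply: le_lt_trans g_fin; rewrite le_eqVlt; apply/orP; left; apply/eqP.
by apply: eq_integral => z _ /=; rewrite ger0_norm//; exact: (kernel_ge0 kg).
Qed.

Lemma integrable_mul_kernel (h : 'rV[R]_d -> R) (C : R) :
  measurable_fun setT h -> (forall z, enorm z < delta -> `|h z| <= C) ->
  lebesgue_rV.-integrable setT (EFin \o (fun z => h z * k z)).
Proof.
move=> mh hC; apply: le_integrable (integrableZl measurableT `|C| integrable_kernel)
    => //.
  apply/measurable_EFinP/measurable_funM => //; exact: (kernel_measurable kg).
move=> z _ /=; rewrite lee_fin !normrM normr_id.
have [zd|dz] := ltP (enorm z) delta; last by rewrite (kernel_eq0 kg)// normr0 !mulr0.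
by rewrite ler_wpM2r// (le_trans (hC _ zd))// ler_norm.
Qed.

Lemma Rintegral_isometry (s : {perm 'I_d}) (a b : 'I_d -> R) (f : 'rV[R]_d -> R) :
  (forall i, `|a i| = 1) -> measurable_fun setT f ->
  \int[lebesgue_rV]_z f (affine_coord s a b z) = \int[lebesgue_rV]_z f z.
Proof.
by move=> a1 mf; rewrite /Rintegral (@integral_isometry R d s a b a1 (EFin \o f))//;
    exact/measurable_EFinP.
Qed.

Lemma kernel_isometry (s : {perm 'I_d}) (a : 'I_d -> R) z :
  (forall i, `|a i| = 1) -> k (affine_coord s a (fun=> 0) z) = k z.
Proof.
move=> a1; apply: (kernel_enorm kg); rewrite !enormE; congr Num.sqrt.
rewrite [RHS](reindex_inj (@perm_inj _ s)); apply: eq_bigr => i _.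
by rewrite mxE addr0 exprMn -[a i ^+ 2]real_normK ?num_real// a1 expr1n mul1r.
Qed.

Let measurable_coord' (i : 'I_d) : measurable_fun setT (fun z : 'rV[R]_d => z ord0 i).
Proof. exact: measurable_coord. Qed.

Lemma kernel_first_moment i : \int[lebesgue_rV]_z (z ord0 i * k z) = 0.
Proof.
have iz : lebesgue_rV.-integrable setT (EFin \o (fun z : 'rV[R]_d => z ord0 i * k z)).
  apply: (@integrable_mul_kernel _ delta) => // z zd.
  by rewrite (le_trans (enorm_coord z i))// ltW.
have a1 (l : 'I_d) : `|-1 : R| = 1 by rewrite normrN1.
have mz : measurable_fun setT (fun z : 'rV[R]_d => z ord0 i * k z).
  by apply/measurable_EFinP; exact: measurable_int iz.
have := Rintegral_isometry 1%g (fun=> 0) a1 mz.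
rewrite (_ : (fun z => _) = (fun z : 'rV[R]_d => -1 * (z ord0 i * k z))); last first.
  apply/funext => z; rewrite kernel_isometry//.
  by rewrite mxE perm1 addr0 mulrA.
by rewrite RintegralZl// mulN1r => /esym/eqP; rewrite -addr_eq0 -mulr2n mulrn_eq0 => /eqP.
Qed.

Lemma integrable_second_moment i j :
  lebesgue_rV.-integrable setT (EFin \o (fun z : 'rV[R]_d => z ord0 i * z ord0 j * k z)).
Proof.
apply: (@integrable_mul_kernel _ (delta * delta)); first exact: measurable_funM.
by move=> z zd; rewrite normrM ler_pM// (le_trans (enorm_coord z _))// ltW.
Qed.

(** Changing the sign of coordinate [i] alone preserves the kernel and reverses the integrand. *)
Lemma kernel_second_moment_neq i j : i != j ->
  \int[lebesgue_rV]_z (z ord0 i * z ord0 j * k z) = 0.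
Proof.
move=> ij; have iz := integrable_second_moment i j.
pose a (l : 'I_d) : R := if l == i then -1 else 1.
have a1 l : `|a l| = 1 by rewrite /a; case: ifP; rewrite ?normrN1 ?normr1.
have mz : measurable_fun setT (fun z : 'rV[R]_d => z ord0 i * z ord0 j * k z).
  by apply/measurable_EFinP; exact: measurable_int iz.
have := Rintegral_isometry 1%g (fun=> 0) a1 mz.
rewrite (_ : (fun z => _) = (fun z : 'rV[R]_d => -1 * (z ord0 i * z ord0 j * k z)));
    last first.
  apply/funext => z; rewrite kernel_isometry// !mxE !perm1 !addr0 /a eqxx.
  by rewrite eq_sym (negbTE ij); ring.
by rewrite RintegralZl// mulN1r => /esym/eqP; rewrite -addr_eq0 -mulr2n mulrn_eq0 => /eqP.
Qed.

(** Swapping two coordinates preserves the kernel, so the d diagonal moments coincide; their sum is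
    the moment d of |z|^2. *)
Lemma kernel_second_moment_eq i : \int[lebesgue_rV]_z (z ord0 i * z ord0 i * k z) = 1.
Proof.
pose c := \int[lebesgue_rV]_(z in [set: 'rV[R]_d]) (z ord0 i * z ord0 i * k z).
have cE j : \int[lebesgue_rV]_z (z ord0 j * z ord0 j * k z) = c.
  have a1 (l : 'I_d) : `|1 : R| = 1 by rewrite normr1.
  have iz := integrable_second_moment i i.
  have mz : measurable_fun setT (fun z : 'rV[R]_d => z ord0 i * z ord0 i * k z).
    by apply/measurable_EFinP; exact: measurable_int iz.
  rewrite /c -(Rintegral_isometry (tperm i j) (fun=> 0) a1 mz).
  apply: eq_Rintegral => z _.
  by rewrite kernel_isometry// !mxE tpermL mul1r addr0.
have : \sum_(j < d) \int[lebesgue_rV]_z (z ord0 j * z ord0 j * k z) = d%:R.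
  rewrite -Rintegral_sum//; last by move=> j; exact: integrable_second_moment.
  rewrite -[RHS]/(fine d%:R%:E) -(kernel_second_moment_enorm kg).
  congr fine; apply: eq_integral => z _; congr EFin.
  by rewrite sqr_enorm mulr_suml; apply: eq_bigr => j _; rewrite expr2.
under eq_bigr do rewrite cE.
rewrite sumr_const card_ord => h.
have d0 : d%:R != 0 :> R by rewrite pnatr_eq0.
by apply: (mulIf d0); rewrite mul1r mulr_natr; exact: h.
Qed.

(** The form is contracted with the matrix of second moments, which is the identity, and only the
    trace remains: for a Hessian, the Laplacian with constant 1. *)
Lemma kernel_quadratic_moment (H : 'I_d -> 'I_d -> R) :
  \int[lebesgue_rV]_z ((\sum_i \sum_j H i j * (z ord0 i * z ord0 j)) * k z) = \sum_i
      H i i.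
Proof.
have iH i j : lebesgue_rV.-integrable setT (EFin \o (fun z : 'rV[R]_d => H i j * (z
    ord0 i * z ord0 j * k z))).
  exact: (integrableZl measurableT (H i j) (integrable_second_moment i j)).
rewrite (_ : (fun z => _) = fun z : 'rV[R]_d =>
    \sum_i \sum_j H i j * (z ord0 i * z ord0 j * k z)); last first.
  apply/funext => z; rewrite mulr_suml; apply: eq_bigr => i _.
  by rewrite mulr_suml; apply: eq_bigr => j _; rewrite -!mulrA.
rewrite Rintegral_sum; [|by []|]; last first.
  move=> i; rewrite (_ : _ \o _ = fun z : 'rV[R]_d => (\sum_j (H i j * (z ord0 i * z
      ord0 j * k z))%:E)%E).
    by apply: integrable_sum => // j _; exact: iH.
  by apply/funext => z /=; rewrite sumEFin.
apply: eq_bigr => i _; rewrite Rintegral_sum// (bigD1 i)//= RintegralZl//; last first.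
  exact: integrable_second_moment.
rewrite kernel_second_moment_eq mulr1 big1 ?addr0// => j ji.
rewrite RintegralZl//; last exact: integrable_second_moment.
by rewrite kernel_second_moment_neq 1?eq_sym// mulr0.
Qed.

End moments.

(** * Taylor expansion along a line *)

(** One limit of difference quotients carries both halves of [is_derive], existence and value. *)
Lemma is_deriveP (R : realType) (V : normedModType R) (f : V -> R) (x v : V) (b : R) :
  is_derive x v f b <->
  h^-1 * (f (h *: v + x) - f x) @[h --> 0^'] --> b.
Proof.
split; first by move=> [df <-]; exact: df.
move=> fb; apply: DeriveDef; first by apply/cvg_ex; exists b.
exact: cvg_lim.
Qed.

Section directional.
Context {R : realType} {V : normedModType R}.
Implicit Types (f : V -> R) (p x v w : V).

(** The two difference quotients are the same expression, so derivatives along [v] become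
    derivatives in one real variable. *)
Lemma is_derive_line f p v (s b : R) :
  is_derive (s *: v + p) v f b <-> is_derive s 1 (fun t => f (t *: v + p)) b.
Proof.
rewrite 2!is_deriveP.
rewrite (_ : (fun h => _ * (f (h *: v + _) - _)) =
  (fun h => h^-1 * (f ((h *: 1 + s) *: v + p) - f (s *: v + p)))).
  by [].
by apply/funext => h; rewrite scalerDl addrA [h *: 1]mulr1.
Qed.

Lemma is_derive_scale_dir f x v (c b : R) :
  is_derive x v f b -> is_derive x (c *: v) f (c * b).
Proof.
move=> fb.
suff : is_derive (0 *: (c *: v) + x) (c *: v) f (c * b) by rewrite scale0r add0r.
apply/is_derive_line.
rewrite (_ : (fun t => _) = (fun t => f (t *: v + x)) \o (fun t => t * c)); last first.
  by apply/funext => t /=; rewrite scalerA.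
rewrite mulrC; apply: is_derive1_comp.
  by apply/is_derive_line; rewrite mul0r scale0r add0r.
apply: is_derive_eq.
by rewrite /= scaler0 add0r [c *: 1]mulr1.
Qed.

(** The sign of [h] is arbitrary because it comes from a two-sided difference quotient; the
    intermediate point is located only by |t| <= |h|. *)
Lemma mean_value_origin (f df : R -> R) (h : R) :
  (forall t : R, `|t| <= `|h| -> is_derive t 1 f (df t)) ->
  exists2 t, `|t| <= `|h| & f h - f 0 = df t * h.
Proof.
move=> fdf.
have cf (a b : R) : (forall t : R, t \in `[a, b]%R -> `|t| <= `|h|) -> {within `[a,
    b], continuous f}.
  move=> ab; apply: derivable_within_continuous => t /ab /fdf[] //.
have [h0|h0] := leP 0 h.
  have hb t : t \in `[0, h]%R -> `|t| <= `|h|.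
    by rewrite in_itv/= => /andP[t0 th]; rewrite !ger0_norm.
  have [t th E] := MVT_segment h0 (fun t th => fdf t (hb _ (subset_itv_oo_cc th)))
      (cf _ _ hb).
  by exists t; [exact: hb|rewrite E subr0].
have hb t : t \in `[h, 0]%R -> `|t| <= `|h|.
  by rewrite in_itv/= => /andP[th t0]; rewrite !ler0_norm ?lerN2// ltW.
have [t th E] := MVT_segment (ltW h0) (fun t th => fdf t (hb _ (subset_itv_oo_cc
    th))) (cf _ _ hb).
by exists t; [exact: hb|rewrite -opprB E sub0r mulrN opprK].
Qed.

(* The increment along v is handled by the mean value theorem at points moving
   with h; along w the difference quotient at x suffices. *)
Lemma is_derive_add_dir f (a : V -> R) x v w (b : R) :
  (\forall y \near x, is_derive y v f (a y)) -> {for x, continuous a} ->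
  is_derive x w f b -> is_derive x (v + w) f (a x + b).
Proof.
move=> fa ca /is_deriveP fb; apply/is_deriveP.
rewrite (_ : (fun h : R => _) = (fun h => h^-1 * (f (h *: v + (h *: w + x)) - f (h *:
    w + x)) +
    h^-1 * (f (h *: w + x) - f x))); last first.
  by apply/funext => h; rewrite -mulrDr scalerDr addrA addrA subrK.
apply: cvgD fb.
apply/cvgrPdist_lt => e e0.
have : \forall y \near x, is_derive y v f (a y) /\ `|a x - a y| < e.
  near=> y; split; near: y => //.
  by move/cvgrPdist_lt : ca; apply.
move=> /nbhs_ballP[r /= r0 xr].
have K0 : 0 < `|v| + `|w| + 1 by rewrite ltr_wpDl.
near=> h.
have hr : `|h| * (`|v| + `|w| + 1) < r.
  rewrite -ltr_pdivlMr//; near: h.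
  by apply: dnbhs0_lt; rewrite divr_gt0.
have h0 : h != 0 by near: h; exact: nbhs_dnbhs_neq.
have inb t : `|t| <= `|h| -> ball x r (t *: v + (h *: w + x)).
  move=> th; rewrite -ball_normE/= opprD opprD !addrA [x - _]addrC.
  rewrite -addrA [- (h *: w) - x]addrC addrA addrK.
  rewrite -opprD normrN (le_lt_trans (ler_normD _ _))// !normrZ.
  apply: le_lt_trans hr; rewrite !mulrDr mulr1.
  by rewrite ler_wpDr// lerD// ler_wpM2r.
have [t th] := @mean_value_origin (fun t => f (t *: v + (h *: w + x)))
    (fun t => a (t *: v + (h *: w + x))) h
    (fun t th => (is_derive_line _ _ _ _ _).1 (xr _ (inb _ th)).1).
rewrite scale0r add0r => ->.
by rewrite mulrCA mulVf// mulr1; exact: (xr _ (inb _ th)).2.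
Unshelve. all: by end_near. Qed.

End directional.

Section taylor.
Context {R : realType} (d : nat).
Implicit Types (D : set 'rV[R]_d) (f : 'rV[R]_d -> R).
Local Notation e_ i := (delta_mx ord0 i : 'rV[R]_d).

Lemma Cb_continuous n D f x : open D -> Cb n D f -> D x -> {for x, continuous f}.
Proof.
move=> oD fD Dx.
have : {within D, continuous f} by case: n fD => [|n] [].
by rewrite continuous_open_subspace// => /(_ x (mem_set Dx)).
Qed.

(* Iterated derivative along z, expanded in partial derivatives because [Cb] only
   speaks of those. *)
Fixpoint dir_derive (k : nat) (z : 'rV[R]_d) f (y : 'rV[R]_d) : R :=
  if k is k'.+1 then \sum_i z ord0 i * dir_derive k' z (partial i f) y else f y.

(** The coordinates of [z] are added one at a time by [is_derive_add_dir]: the new partial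
    derivative is continuous near [x], and of the directions summed so far only the derivative at
    [x] is used. *)
Lemma is_derive_dir D f x z : open D -> Cb 1 D f -> D x ->
  is_derive x z f (dir_derive 1 z f x).
Proof.
move=> oD fD Dx.
have zE : z = \sum_i z ord0 i *: e_ i by rewrite [LHS]row_sum_delta.
rewrite {1}zE /=; elim: (index_enum _) => [|i r IH].
  rewrite !big_nil; apply/is_deriveP.
  rewrite (_ : (fun h : R => _) = cst 0); first exact: cvg_cst.
  by apply/funext => h; rewrite scaler0 add0r subrr mulr0.
rewrite !big_cons.
have [_ _ /(_ i)[df dc]] := fD.
apply: (@is_derive_add_dir _ _ _ (fun y => z ord0 i * partial i f y)) => //.
- have : nbhs x D by apply: open_nbhs_nbhs.
  apply: filterS => y Dy; apply: is_derive_scale_dir.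
  by apply: DeriveDef => //; exact: df.
- have c : {for x, continuous (partial i f)} by exact: (@Cb_continuous 0 D _ x oD dc Dx).
  have c' : {for x, continuous (fun=> z ord0 i : R)} by exact: (@cst_continuous _ _
      (z ord0 i) x).
  exact: (continuousM c' c).
Qed.

Lemma is_derive_dir_line k D f (p z : 'rV[R]_d) (t : R) : open D -> Cb k.+1 D f ->
  D (t *: z + p) ->
  is_derive t 1 (fun s => dir_derive k z f (s *: z + p)) (dir_derive k.+1 z f (t *: z
      + p)).
Proof.
move=> oD; elim: k f => [|k IH] f fD Dt.
  exact: (is_derive_line f p z t _).1 (is_derive_dir z oD fD Dt).
have [_ _ fD'] := fD.
have h i : is_derive t 1 (fun s => dir_derive k z (partial i f) (s *: z + p))
    (dir_derive k.+1 z (partial i f) (t *: z + p)).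
  by apply: IH => //; have [] := fD' i.
have := is_derive_sum (fun i => is_deriveZ (z ord0 i) (h i)).
rewrite (_ : \sum_(i < d) _ = fun s => dir_derive k.+1 z f (s *: z + p))//.
by apply/funext => s; rewrite fct_sumE.
Qed.

(** The bounds of all partial derivatives of order [k] are added up; the l^1 norm of [z] is what
    expanding the iterated sum produces. *)
Lemma dir_derive_bound k D f : Cb k D f -> exists2 M, 0 <= M &
  forall x z, D x -> `|dir_derive k z f x| <= M * (\sum_i `|z ord0 i|) ^+ k.
Proof.
elim: k f => [|k IH] f.
  move=> [_ [M [_ fM]] _]; exists (`|M| + 1); first by rewrite addr_ge0.
  move=> x z Dx; rewrite expr0 mulr1 /=; apply: fM => //.
  by rewrite (le_lt_trans (ler_norm M))// ltrDl.
move=> [_ _ fD].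
have /choice[M MP] : forall i, exists M, 0 <= M /\
  forall x z, D x -> `|dir_derive k z (partial i f) x| <= M * (\sum_i `|z ord0 i|) ^+ k.
  by move=> i; have [_ /IH[M M0 h]] := fD i; exists M.
exists (\sum_i M i); first by rewrite sumr_ge0// => i _; have [] := MP i.
move=> x z Dx /=; rewrite (le_trans (ler_norm_sum _ _ _))//.
rewrite exprS mulrCA mulrA mulr_suml [leRHS]mulr_suml; apply: ler_sum => i _.
rewrite normrM -mulrA ler_wpM2l//.
have [M0 h] := MP i; apply: le_trans (h x z Dx) _.
rewrite ler_wpM2r ?exprn_ge0 ?sumr_ge0//.
by rewrite (bigD1 i)//= lerDl sumr_ge0// => j _; have [] := MP j.
Qed.

(** On an interval of length at most 1 the mean value theorem passes the bound of the derivative to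
    the function unchanged, so the step can be iterated. *)
Lemma ler_norm_derive (F F' : R -> R) (B : R) :
  (forall t : R, 0 <= t <= 1 -> is_derive t 1 F (F' t)) -> F 0 = 0 ->
  (forall t : R, 0 <= t <= 1 -> `|F' t| <= B) ->
  forall t : R, 0 <= t <= 1 -> `|F t| <= B.
Proof.
move=> dF F0 F'B t /andP[t0 t1].
have le1 s : s \in `[0, t]%R -> 0 <= s <= 1.
  by rewrite in_itv/= => /andP[-> st]; exact: le_trans t1.
have cF : {within `[0, t], continuous F}.
  by apply: derivable_within_continuous => s /le1 /dF[].
have [s st E] := MVT_segment t0 (fun s st => dF s (le1 _ (subset_itv_oo_cc st))) cF.
move: E; rewrite F0 !subr0 => ->; rewrite normrM (ger0_norm t0).
have B0 : 0 <= B by apply: le_trans (F'B 0 _); rewrite ?lexx ?ler01.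
by rewrite -[leRHS]mulr1 ler_pM// F'B// le1.
Qed.

Lemma CbW n D f : Cb n.+1 D f -> Cb n D f.
Proof.
elim: n f => [|n IH] f [cf bf fD]; first by split.
split=> // i; split; first by have [] := fD i.
by apply: IH; have [] := fD i.
Qed.

(** Odd derivatives at 0 cancel in f(x + tz) + f(x - tz), so the remainder is of order 4. Four
    applications of the mean value theorem carry down the bound 2 M of the symmetrised fourth
    derivative; Taylor's factor 1/24 is given up. *)
Lemma symmetric_taylor D f (x z : 'rV[R]_d) (M : R) : open D -> Cb 4 D f ->
  (forall t : R, `|t| <= 1 -> D (t *: z + x)) ->
  (forall y, D y -> `|dir_derive 4 z f y| <= M) ->
  `|f (z + x) + f (- z + x) - 2 * f x - dir_derive 2 z f x| <= 2 * M.
Proof.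
move=> oD fD Dz fM.
pose phi k (t : R) : R := dir_derive k z f (t *: z + x).
have dphi k (t : R) : (k < 4)%N -> `|t| <= 1 -> is_derive t 1 (phi k) (phi k.+1 t).
  move=> k4 t1; apply: (is_derive_dir_line oD _ (Dz t t1)).
  by move: k k4 => [|[|[|[|//]]]] _; do ?[exact: fD | apply: CbW].
have dphiN k (t : R) : (k < 4)%N -> `|t| <= 1 ->
    is_derive t 1 (fun s => phi k (- s)) (- phi k.+1 (- t)).
  move=> k4 t1.
  have h := @is_derive1_comp R (phi k) -%R t _ _ (dphi k (- t) k4 _) (is_deriveN
      (is_derive_id t 1)).
  rewrite -[X in is_derive _ _ _ X]mulrN1; apply: h; by rewrite normrN.
have n1 (t : R) : 0 <= t <= 1 -> `|t| <= 1 by move=> /andP[t0 t1]; rewrite ger0_norm.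
(* G4, ..., G0 bound successive antiderivatives, all vanishing at 0. *)
have G4 (t : R) : 0 <= t <= 1 -> `|phi 4 t + phi 4 (- t)| <= 2 * M.
  move=> /n1 t1; rewrite (le_trans (ler_normD _ _))// mulr_natl mulr2n lerD// fM//;
      apply: Dz => //.
  by rewrite normrN.
have G3 : forall t : R, 0 <= t <= 1 -> `|phi 3 t - phi 3 (- t)| <= 2 * M.
  apply: (@ler_norm_derive (fun t => phi 3 t - phi 3 (- t)) _ _ _ _ G4) => [s /n1
      s1|]; last by rewrite oppr0 subrr.
  by apply: (is_derive_eq (is_deriveB (dphi 3 s _ s1) (dphiN 3 s _ s1))); rewrite //
      opprK.
have G2 : forall t : R, 0 <= t <= 1 -> `|phi 2 t + phi 2 (- t) - 2 * phi 2 0| <= 2 * M.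
  apply: (@ler_norm_derive (fun t => phi 2 t + phi 2 (- t) - 2 * phi 2 0) _ _ _ _ G3)
      => [s /n1 s1|]; last by rewrite oppr0; ring.
  apply: (is_derive_eq (is_deriveB (is_deriveD (dphi 2 s _ s1) (dphiN 2 s _ s1))
      (is_derive_cst _ _ _))) => //.
  by rewrite subr0.
have G1 : forall t : R, 0 <= t <= 1 -> `|phi 1 t - phi 1 (- t) - 2 * phi 2 0 * t| <=
    2 * M.
  apply: (@ler_norm_derive (fun t => phi 1 t - phi 1 (- t) - 2 * phi 2 0 * t) _ _ _ _
      G2) => [s /n1 s1|]; last by rewrite oppr0; ring.
  apply: (is_derive_eq (is_deriveB (is_deriveB (dphi 1 s _ s1) (dphiN 1 s _ s1))
      (is_deriveZ (2 * phi 2 0) (is_derive_id s 1)))) => //.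
  by rewrite opprK [_ *: 1]mulr1.
have G0 : forall t : R, 0 <= t <= 1 -> `|phi 0 t + phi 0 (- t) - 2 * phi 0 0 - phi 2
    0 * t ^+ 2| <= 2 * M.
  apply: (@ler_norm_derive (fun t => phi 0 t + phi 0 (- t) - 2 * phi 0 0 - phi 2 0 *
      t ^+ 2) _ _ _ _ G1) => [s /n1 s1|]; last by rewrite oppr0; ring.
  have d2 : is_derive s 1 (fun t : R => phi 2 0 * t ^+ 2) (2 * phi 2 0 * s).
    have h := DeriveDef (@exprn_derivable R 2 s 1) (exp_derive 2 s 1).
    apply: (is_derive_eq (is_deriveZ (phi 2 0) h)).
    by rewrite /GRing.scale/= mulr1 expr1; ring.
  apply: (is_derive_eq (is_deriveB (is_deriveB (is_deriveD (dphi 0 s _ s1) (dphiN 0 s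
      _ s1)) (is_derive_cst _ _ _)) d2)) => //.
  by rewrite subr0.
have := G0 1; rewrite ler01 lexx => /(_ isT).
by rewrite /phi scaleN1r !scale1r scale0r add0r expr1n mulr1.
Qed.

End taylor.

(** * The collar of a polyhedron *)

Section domain.
Context {R : realType} (d : nat).
Implicit Types (Omega A : set 'rV[R]_d) (x y z : 'rV[R]_d).

Lemma dist_to_lt A y (r : R) :
  (dist_to y A < r%:E)%E <-> exists2 z, A z & enorm (y - z) < r.
Proof.
split; first by move=> /ereal_inf_lt[_ [z Az <-]]; rewrite lte_fin; exists z.
move=> [z Az yz]; apply: (@le_lt_trans _ _ (enorm (y - z))%:E); last by rewrite lte_fin.
by apply: ereal_inf_lbound; exists z.
Qed.

Lemma open_boundary Omega z : open Omega ->
  boundary Omega z <-> closure Omega z /\ ~ Omega z.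
Proof. by move=> /interior_id oO; rewrite /boundary oO. Qed.

(** The point sought sits at the infimum of the parameters whose points are outside Omega: as Omega
    is open it is itself outside, and earlier points, all in Omega, accumulate at it. *)
Lemma segment_crosses_boundary Omega x y : open Omega -> Omega x -> ~ Omega y ->
  exists2 z, boundary Omega z & exists2 t : R, 0 <= t < 1 & y - z = t *: (y - x).
Proof.
move=> oO Ox nOy.
pose w (t : R) := t *: (y - x) + x.
pose T : set R := [set t | 0 <= t <= 1 /\ ~ Omega (w t)].
have T1 : T 1 by split; [rewrite ler01 lexx|rewrite /w scale1r subrK].
have T0 : lbound T 0 by move=> t [/andP[]].
have hT : has_inf T by split; [exists 1|exists 0].
have s0 : 0 <= inf T by apply: lb_le_inf => //; exists 1.
have s1 : inf T <= 1 by apply: ge_inf => //; exists 0.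
have cw : {for inf T, continuous w}.
  apply: (@continuousD _ _ _ (fun t : R => t *: (y - x)) (cst x)).
    exact: scalel_continuous.
  exact: cst_continuous.
have near_w B : nbhs (w (inf T)) B ->
    exists2 r : R, 0 < r & forall t, `|inf T - t| < r -> B (w t).
  by move=> /cw /nbhs_ballP[r r0 h]; exists r.
have nO : ~ Omega (w (inf T)).
  move=> Ow; have [r r0 rO] := near_w _ (open_nbhs_nbhs (conj oO Ow)).
  have [t [t01 nOt] tr] := inf_adherent r0 hT.
  have tT : inf T <= t by apply: ge_inf; [exists 0|split].
  by apply: nOt; apply: rO; rewrite ltr_norml; lra.
have s_gt0 : 0 < inf T.
  rewrite lt_neqAle s0 andbT; apply/eqP => s00; apply: nO.
  by rewrite -s00 /w scale0r add0r.
exists (w (inf T)).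
  apply/(open_boundary _ oO); split=> // B /near_w[r r0 rB].
  (* A slightly earlier parameter, nonnegative and below the infimum, hence a point of Omega in the
     given neighbourhood. *)
  pose t := Num.max 0 (inf T - r / 2).
  have t0 : 0 <= t by rewrite le_max lexx.
  have ts : t < inf T by rewrite gt_max s_gt0/= ltrBlDr ltrDl divr_gt0.
  exists (w t); split; last first.
    apply: rB; rewrite ger0_norm ?subr_ge0 ?ltW//.
    have : inf T - r / 2 <= t by rewrite le_max lexx orbT.
    lra.
  apply: contrapT => nOt; have : inf T <= t.
    by apply: ge_inf; [exists 0|split=> //; rewrite t0; lra].
  lra.
exists (1 - inf T); first by lra.
by rewrite /w opprD addrCA addrC -scaleNr -[X in X + _ = _]scale1r -scalerDl.
Qed.

(** The segment from [x] to [y] meets the boundary at distance at most |y - x| from [y]. Hence the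
    kernel at a point of Omega sees only the extended domain. *)
Lemma eball_ext_domain Omega (delta : R) x y : open Omega -> Omega x ->
  enorm (y - x) < delta -> ext_domain Omega delta y.
Proof.
move=> oO Ox xy; have [Oy|nOy] := pselect (Omega y); [by left|right].
split=> //; apply/dist_to_lt.
have [z bz [t /andP[t0 t1] yz]] := segment_crosses_boundary oO Ox nOy.
exists z => //; rewrite yz enormZ ger0_norm// (le_lt_trans _ xy)//.
by rewrite ler_piMl ?enorm_ge0// ltW.
Qed.

Lemma open_eball_center (r : R) z : open [set y : 'rV[R]_d | enorm (y - z) < r].
Proof.
apply: (@open_comp _ _ (fun y => enorm (y - z)) [set t | t < r]); last exact: open_lt.
move=> y _; apply: (@continuous_comp _ _ _ (fun y => y - z) (@enorm R d)).
  apply: (@continuousB _ _ _ id (cst z)); [exact: cvg_id|exact: cst_continuous].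
exact: enorm_continuous.
Qed.

(** As a union with open balls the extended domain is visibly open and increasing in [delta]. *)
Lemma ext_domainE Omega (delta : R) : ext_domain Omega delta =
  Omega `|` \bigcup_(z in boundary Omega) [set y | enorm (y - z) < delta].
Proof.
apply/seteqP; split=> y [Oy|]; [by left| |by left|].
  by move=> [_ /dist_to_lt[z bz yz]]; right; exists z.
move=> [z bz yz]; have [Oy|nOy] := pselect (Omega y); [by left|right].
by split=> //; apply/dist_to_lt; exists z.
Qed.

Lemma open_ext_domain Omega (delta : R) : open Omega -> open (ext_domain Omega delta).
Proof.
move=> oO; rewrite ext_domainE; apply: openU => //; apply: bigcup_open => z _.
exact: open_eball_center.
Qed.

Lemma ext_domainS Omega (delta delta' : R) : delta <= delta' ->
  ext_domain Omega delta `<=` ext_domain Omega delta'.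
Proof.
move=> dd; rewrite !ext_domainE; apply: setUS; apply: subset_bigcup => z _ y /=.
by move=> /lt_le_trans; exact.
Qed.

Lemma measurable_collar Omega (delta : R) : open Omega -> measurable (collar Omega delta).
Proof.
move=> oO; rewrite (_ : collar _ _ = ext_domain Omega delta `\` Omega).
  by apply: measurableD; apply: open_measurable_rV => //; exact: open_ext_domain.
apply/seteqP; split=> y; first by move=> [nO yd]; split=> //; right.
by move=> [[//|]].
Qed.

(** One cube has to serve every horizon up to 1, since the constants of the final estimates depend
    on it. *)
Lemma ext_domain_bounded Omega : open Omega -> bounded_set Omega ->
  exists2 M : R, 0 < M & forall delta, delta <= 1 -> ext_domain Omega delta `<=` cube M.
Proof.
move=> oO [M [_ OM]]; pose N := `|M| + 1.
have ON x i : Omega x -> `|x ord0 i| <= N.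
  move=> Ox; have : `|x| <= N by apply: OM => //; rewrite (le_lt_trans (ler_norm
      M))// ltrDl.
  by apply: le_trans; rewrite [leRHS]mx_normrE; exact: (le_bigmax _ (fun ij => `|x
      ij.1 ij.2|) (ord0, i)).
have N0 : 0 < N by rewrite ltr_wpDl.
(* [N] for a point of Omega, 1 from there to a boundary point, at most 1 for [delta]; the rest is
   slack. *)
exists (N + 3); first by rewrite addr_gt0.
move=> delta d1; rewrite ext_domainE => y [Oy|[z bz yz]] i /=; rewrite in_itv/=
    -ltr_norml.
  by rewrite (le_lt_trans (ON _ _ Oy))// ltrDl.
have [clz _] := (open_boundary z oO).1 bz.
have [x [Ox [_ zx]]] := clz _ (nbhsx_ballx z 1 ltr01).
have h1 : `|z ord0 i - x ord0 i| < 1 by exact: zx.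
have h2 : `|y ord0 i - z ord0 i| < delta.
  by have := enorm_coord (y - z) i; rewrite !mxE => /le_lt_trans; exact.
have h3 := ON x i Ox.
rewrite (_ : y ord0 i = (y ord0 i - z ord0 i) + (z ord0 i - x ord0 i) + x ord0 i);
    last by ring.
rewrite (le_lt_trans (ler_normD _ _))//; have := ler_normD (y ord0 i - z ord0 i) (z
    ord0 i - x ord0 i).
lra.
Qed.

End domain.

Section dotrV.
Context {R : realType} (d : nat).
Implicit Types (a x y : 'rV[R]_d).

Lemma dotrVDr a x y : dotrV a (x + y) = dotrV a x + dotrV a y.
Proof. by rewrite -big_split; apply: eq_bigr => i _; rewrite mxE mulrDr. Qed.

Lemma dotrVZr a (c : R) x : dotrV a (c *: x) = c * dotrV a x.
Proof. by rewrite [RHS]mulr_sumr; apply: eq_bigr => i _; rewrite mxE mulrCA. Qed.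

Lemma dotrVBr a x y : dotrV a (x - y) = dotrV a x - dotrV a y.
Proof. by rewrite dotrVDr -scaleN1r dotrVZr mulN1r. Qed.

Lemma dotr0V x : dotrV 0 x = 0.
Proof. by rewrite /dotrV big1// => i _; rewrite mxE mul0r. Qed.

Lemma dotrV_eq0 a : dotrV a a = 0 -> a = 0.
Proof. by move=> a0; apply: enorm_eq0; rewrite /enorm a0 sqrtr0. Qed.

Lemma ler_norm_dotrV a x : `|dotrV a x| <= (\sum_i `|a ord0 i|) * enorm x.
Proof.
rewrite (le_trans (ler_norm_sum _ _ _))// mulr_suml ler_sum// => i _.
by rewrite normrM ler_wpM2l// enorm_coord.
Qed.

End dotrV.

Section polyhedron.
Context {R : realType} (d : nat).
Implicit Types (hs : seq ('rV[R]_d * R)) (z : 'rV[R]_d).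

Lemma closed_convex_polyhedron hs : closed (convex_polyhedron hs).
Proof.
rewrite (_ : convex_polyhedron hs =
    \bigcap_(h in [set` hs]) (dotrV h.1 @^-1` [set t | t <= h.2])) //.
apply: closed_bigI => h _; apply: preimage_closed; last exact: closed_le.
by move=> x _; exact: dotrV_continuous.
Qed.

(** Strict inequalities persist nearby, and a constraint with zero normal that holds at [z] holds
    everywhere. *)
Lemma near_convex_polyhedron hs z : convex_polyhedron hs z ->
  (forall h, h \in hs -> h.1 != 0 -> dotrV h.1 z != h.2) ->
  nbhs z (convex_polyhedron hs).
Proof.
elim: hs => [|h hs IH] Pz nz; first by apply: filterS filterT => y _ h.
have Phs : nbhs z (convex_polyhedron hs).
  apply: IH => [h' hh'|h' hh']; first by apply: Pz; rewrite in_cons hh' orbT.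
  by apply: nz; rewrite in_cons hh' orbT.
have hin : h \in h :: hs by rewrite mem_head.
have Ph : nbhs z [set y | dotrV h.1 y <= h.2].
  have [h0|h0] := eqVneq h.1 0.
    have := Pz h hin; rewrite h0 dotr0V => h2.
    by apply: filterS filterT => y _ /=; rewrite dotr0V.
  have ltz : dotrV h.1 z < h.2 by rewrite lt_neqAle nz// Pz.
  have le : nbhs (dotrV h.1 z) [set t | t <= h.2] by move/lt_nbhsl : ltz; apply:
      filterS => t /ltW.
  exact: (@dotrV_continuous R d h.1 z _ le).
apply: filterS2 Ph Phs => y hy hsy h'; rewrite in_cons => /orP[/eqP ->//|].
exact: hsy.
Qed.

(** A boundary point is a limit of Omega, hence lies in the closed union and in one of its
    polyhedra. Off all the hyperplanes it would be interior to that polyhedron, hence a point of the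
    open set Omega. *)
Lemma boundary_polyhedron (ps : seq (seq ('rV[R]_d * R))) (Omega : set 'rV[R]_d) z :
  Omega = interior (\bigcup_(hs in [set` ps]) convex_polyhedron hs) ->
  boundary Omega z ->
  exists2 h, h \in flatten ps & h.1 != 0 /\ dotrV h.1 z = h.2.
Proof.
set U := \bigcup_(_ in _) _ => OU bz.
have oO : open Omega by rewrite OU; exact: open_interior.
have [cz nz] := (open_boundary z oO).1 bz.
have clU : closed U.
  apply: closed_bigcup; first exact: finite_seq.
  by move=> hs _; exact: closed_convex_polyhedron.
have OsU : Omega `<=` U by rewrite OU; exact: interior_subset.
have [hs hps Pz] : U z by exact: (clU _ (closure_subset OsU cz)).
apply: contrapT => nh; apply: nz; rewrite OU.
have : nbhs z (convex_polyhedron hs).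
  apply: near_convex_polyhedron Pz _ => h hhs h0; apply/negP => /eqP hz.
  by apply: nh; exists h => //; apply/flattenP; exists hs.
by apply: filterS => y Py; exists hs.
Qed.

End polyhedron.

Section slab.
Context {R : realType} (d : nat).
Implicit Types (a : 'rV[R]_d).

Definition slab (M : R) a (b eta : R) : set 'rV[R]_d :=
  [set y | cube M y /\ `|dotrV a y - b| < eta].

Lemma measurable_slab M a b eta : measurable (slab M a b eta).
Proof.
apply: (@measurableI _ _ (cube M) [set y | `|dotrV a y - b| < eta]).
  exact: measurable_cube.
apply: open_measurable_rV.
apply: (@open_comp _ _ (fun y => `|dotrV a y - b|) [set t | t < eta]); last exact:
    open_lt.
move=> y _; apply: (@continuous_comp _ _ _ (fun y => dotrV a y - b) Num.norm); last
    exact: norm_continuous.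
by apply: (@continuousB _ _ _ (dotrV a) (cst b)); [exact: dotrV_continuous|exact:
    cst_continuous].
Qed.

(* About 1 / (2 eta) translates of the slab in the direction v with a.v = 1 are
   disjoint and lie in a common cube. *)
Lemma slab_volume (M : R) a (b : R) : a != 0 ->
  exists2 C : R, 0 <= C & forall eta, 0 < eta <= 2^-1 ->
    (lebesgue_rV (slab M a b eta) <= (C * eta)%:E)%E.
Proof.
move=> a0; pose v := (dotrV a a)^-1 *: a.
have av : dotrV a v = 1.
  rewrite dotrVZr mulVf//; apply/eqP => /dotrV_eq0 aa0; by rewrite aa0 eqxx in a0.
clearbody v; pose W := enorm v; pose K := fine (lebesgue_rV (cube (M + W) : set
    'rV[R]_d)).
have KE : lebesgue_rV (cube (M + W) : set 'rV[R]_d) = K%:E.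
  by rewrite fineK// ge0_fin_numE ?measure_ge0// lebesgue_rV_cube.
have K0 : 0 <= K by rewrite fine_ge0// measure_ge0.
exists (4 * K); first by rewrite mulr_ge0.
move=> eta /andP[eta0 eta1].
(* Steps of length 2 eta along [v] keep the translates disjoint, and [NL] keeps the total
   displacement below |v|. As eta <= 1/2, truncation loses at most half of 1 / (2 eta), which is
   [NU] and explains the factor 4. *)
pose N := Num.trunc (2 * eta)^-1.
have e2 : 0 < 2 * eta by rewrite mulr_gt0.
have N1 : (1 : R) <= (2 * eta)^-1 by rewrite invf_ge1//; lra.
have NL : 2 * eta * N%:R <= 1.
  by rewrite mulrC -ler_pdivlMr// mul1r truncn_le invr_ge0 ltW.
have NU : 1 <= 4 * eta * N%:R.
  have h1 : (2 * eta)^-1 < N.+1%:R := truncnS_gt _.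
  have h2 : (1 : R) <= N%:R by rewrite ler1n truncn_gt0.
  have : 1 < 2 * eta * N.+1%:R by rewrite mulrC -ltr_pdivrMr// mul1r.
  rewrite -[N.+1%:R]natr1 mulrDr mulr1 => h3.
  have : 2 * eta * 1 <= 2 * eta * N%:R by rewrite ler_pM2l.
  lra.
pose F (k : nat) : set 'rV[R]_d := [set y | slab M a b eta (y + - ((2 * eta * k%:R)
    *: v))].
have mF k : measurable (F k).
  rewrite -[X in measurable X]setTI.
  have mt : measurable_fun setT (fun y : 'rV[R]_d => y + - ((2 * eta * k%:R) *: v)).
    apply: measurable_fun_rVP => i.
    rewrite (_ : (fun _ => _) = fun y : 'rV[R]_d => y ord0 i + (- ((2 * eta * k%:R)
        *: v)) ord0 i); last first.
      by apply/funext => y; rewrite mxE.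
    by apply: measurable_funD => //; exact: measurable_coord.
  exact: (mt measurableT _ (measurable_slab M a b eta)).
have tF : trivIset setT F.
  apply/trivIsetP => i j _ _ ij; apply/seteqP; split=> y // [[_ yi] [_ yj]].
  move: yi yj; rewrite !dotrVBr !dotrVZr av !mulr1 => yi yj.
  have : `|2 * eta * (i%:R - j%:R)| < 2 * eta.
    rewrite (_ : _ * _ = (dotrV a y + - (2 * eta * j%:R) - b) - (dotrV a y + - (2 *
        eta * i%:R) - b)); last by ring.
    by apply: (le_lt_trans (ler_normB _ _)); have := ltrD yj yi; lra.
  rewrite normrM gtr0_norm// -ltr_pdivlMl// mulVf ?gt_eqF//.
  apply/negP; rewrite -leNgt.
  case: (ltngtP i j) ij => // ij _.
    rewrite distrC (le_trans _ (ler_norm _))// lerBrDr nat1r ler_nat; exact: ij.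
  rewrite (le_trans _ (ler_norm _))// lerBrDr nat1r ler_nat; exact: ij.
have FE k : lebesgue_rV (F k) = lebesgue_rV (slab M a b eta).
  exact: lebesgue_rV_translate (measurable_slab M a b eta).
have sub : \big[setU/set0]_(k < N) F k `<=` cube (M + W).
  rewrite -bigcup_mkord => y [k /= kN [yM _]] i /=; rewrite in_itv/= -ltr_norml.
  have := yM i; rewrite /= in_itv/= -ltr_norml !mxE => h1.
  have h2 : `|2 * eta * k%:R * v ord0 i| <= W.
    rewrite normrM -[leRHS]mul1r ler_pM// ?enorm_coord//.
    rewrite ger0_norm ?mulr_ge0// ?(ltW eta0)// (le_trans _ NL)//.
    by rewrite ler_pM2l// ler_nat ltnW.
  rewrite -[y ord0 i](subrK (2 * eta * k%:R * v ord0 i)) (le_lt_trans (ler_normD _ _))//.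
  exact: ltr_leD.
have : (\sum_(k < N) lebesgue_rV (F k) <= K%:E)%E.
  rewrite -KE -(measure_bigsetU _ mF tF); apply: le_measure => //.
  - by apply: mem_set; apply: bigsetU_measurable => k _; exact: mF.
  - exact: (mem_set (@measurable_cube R d _)).
under eq_bigr do rewrite FE.
have [m mE] : exists m, lebesgue_rV (slab M a b eta) = m%:E.
  exists (fine (lebesgue_rV (slab M a b eta))); rewrite fineK// ge0_fin_numE
      ?measure_ge0//.
  apply: le_lt_trans (lebesgue_rV_cube d M); apply: le_measure => //.
  - exact: (mem_set (measurable_slab M a b eta)).
  - exact: (mem_set (@measurable_cube R d _)).
  - by move=> y [].
rewrite mE sumEFin lee_fin sumr_const card_ord -mulr_natr => h.
have m0 : 0 <= m by rewrite -lee_fin -mE measure_ge0.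
rewrite lee_fin.
have h1 : m * 1 <= m * (4 * eta * N%:R) by rewrite ler_wpM2l.
have h2 : 4 * eta * (m * N%:R) <= 4 * eta * K by apply: ler_wpM2l => //; lra.
lra.
Qed.

End slab.

(** A collar point is within [delta] of a boundary point, hence of one of the finitely many
    hyperplanes; slabs of width proportional to [delta] therefore cover the collar. *)
Lemma collar_volume (R : realType) (d : nat) (Omega : set 'rV[R]_d) :
  bounded_open_polyhedron Omega ->
  exists2 C : R, 0 <= C & exists2 r : R, 0 < r & forall delta, 0 < delta < r ->
    (lebesgue_rV (collar Omega delta) <= (C * delta)%:E)%E.
Proof.
move=> [bO [ps OE]].
have oO : open Omega by rewrite OE; exact: open_interior.
have [M M0 OM] := ext_domain_bounded oO bO.
(* Dominates the Lipschitz constant of the linear form; the added 1 keeps it positive, so that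
   strict inequalities survive. *)
pose sa (h : 'rV[R]_d * R) : R := 1 + \sum_i `|h.1 ord0 i|.
have sa0 h : 0 < sa h by rewrite ltr_wpDr// sumr_ge0.
pose covered (hs : seq ('rV[R]_d * R)) (delta : R) (A : set 'rV[R]_d) :=
  forall y, A y -> cube M y /\ exists2 h, h \in hs & h.1 != 0 /\ `|dotrV h.1 y - h.2|
      < sa h * delta.
(* Induction on the hyperplanes, for an arbitrary measurable set: cutting off the slab of the first
   one leaves a set covered by the others. *)
have cover hs : exists2 C : R, 0 <= C & exists2 r : R, 0 < r &
    forall delta, 0 < delta < r -> forall A, measurable A -> covered hs delta A ->
    (lebesgue_rV A <= (C * delta)%:E)%E.
  elim: hs => [|h hs [C C0 [r r0 IH]]].
    exists 0 => //; exists 1 => // delta _ A mA cA.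
    rewrite (_ : A = set0) ?measure0 ?mul0r//.
    by apply/seteqP; split=> y // /cA[_ []].
  have [h0|h0] := eqVneq h.1 0.
    exists C => //; exists r => // delta dr A mA cA; apply: (IH _ dr _ mA) => y
        /cA[cy [h' + [h'0 hy]]].
    rewrite in_cons => /orP[/eqP hh|hin]; first by rewrite hh h0 eqxx in h'0.
    by split=> //; exists h'.
  have [C' C'0 sl] := slab_volume M h.2 h0.
  exists (C' * sa h + C); first by rewrite addr_ge0// mulr_ge0// ltW.
  exists (Num.min r (2^-1 / sa h)); first by rewrite lt_min r0 divr_gt0.
  move=> delta /andP[d0]; rewrite lt_min ltr_pdivlMr// => /andP[dr d2] A mA cA.
  pose S := slab M h.1 h.2 (sa h * delta).
  have mS : measurable S by exact: measurable_slab.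
  have mD : measurable (A `\` S) by exact: measurableD.
  apply: (@le_trans _ _ (lebesgue_rV S + lebesgue_rV (A `\` S))%E).
    apply: le_trans (measureU2 _ mS mD); apply: le_measure.
    - exact: (mem_set mA).
    - exact: (mem_set (measurableU _ _ mS mD)).
    - by move=> y Ay; have [|nS] := pselect (S y); [left|right].
  rewrite mulrDl EFinD; apply: leeD.
    by rewrite -mulrA; apply: sl; rewrite mulr_gt0//= mulrC ltW.
  apply: IH; [by rewrite d0| by [] |move=> y [/cA[cy [h' + [h'0 hy]]] nS]].
  rewrite in_cons => /orP[/eqP hh|hin]; last by split=> //; exists h'.
  by exfalso; apply: nS; split => //; rewrite -hh.
have [C C0 [r r0 hC]] := cover (flatten ps).
exists C => //; exists (Num.min r 1); first by rewrite lt_min r0 ltr01.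
move=> delta /andP[d0]; rewrite lt_min => /andP[dr d1].
apply: hC; [by rewrite d0|exact: measurable_collar|move=> y cy].
split; first by apply: (OM delta (ltW d1)); right.
have [_ /dist_to_lt[z bz yz]] := cy.
have [h hin [h0 hz]] := boundary_polyhedron OE bz.
exists h => //; split=> //; rewrite -hz -dotrVBr.
rewrite (le_lt_trans (ler_norm_dotrV _ _))//.
apply: (@le_lt_trans _ _ (sa h * enorm (y - z))); last by rewrite ltr_pM2l.
by rewrite ler_wpM2r ?enorm_ge0// lerDr.
Qed.

(** * Maximum principle *)

Section measurable_translations.
Context {R : realType} (d : nat).

Lemma measurable_rV_translate (c : 'rV[R]_d) : measurable_fun setT (fun z : 'rV[R]_d
    => z + c).
Proof.
apply: measurable_fun_rVP => i.
rewrite (_ : (fun _ => _) = fun z : 'rV[R]_d => z ord0 i + c ord0 i); last first.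
  by apply/funext => z; rewrite mxE.
by apply: measurable_funD => //; exact: measurable_coord.
Qed.

Lemma measurable_rV_sub :
  measurable_fun setT (fun p : 'rV[R]_d * 'rV[R]_d => p.2 - p.1).
Proof.
apply: measurable_fun_rVP => i.
rewrite (_ : (fun _ => _) = fun p : 'rV[R]_d * 'rV[R]_d => p.2 ord0 i - p.1 ord0 i);
    last first.
  by apply/funext => p; rewrite !mxE.
apply: measurable_funB.
  by apply: (measurableT_comp (@measurable_coord R d i)); exact: measurable_snd.
by apply: (measurableT_comp (@measurable_coord R d i)); exact: measurable_fst.
Qed.

End measurable_translations.

Section kernel_integrals.
Context {R : realType} (n : nat) (delta : R) (g : 'rV[R]_n.+1 -> 'rV[R]_n.+1 -> R).
Hypothesis kg : kernel_conditions delta g.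
Hypothesis g_fin : (\int[lebesgue_rV]_z (g 0 z)%:E < +oo)%E.
Local Notation k := (g 0).
Local Notation d := n.+1.
Local Notation m := (\int[lebesgue_rV]_(z in [set: 'rV[R]_d]) k z).

Lemma measurable_kernel_at x : measurable_fun setT (g x).
Proof.
rewrite (_ : g x = k \o (fun y => y + - x)); last first.
  by apply/funext => y; exact: kernel_translate kg x y.
by apply: measurableT_comp; [exact: (kernel_measurable kg)|exact:
    measurable_rV_translate].
Qed.

Lemma measurable_kernel2 : measurable_fun setT (fun p : 'rV[R]_d * 'rV[R]_d => g p.1 p.2).
Proof.
rewrite (_ : (fun _ => _) = k \o (fun p : 'rV[R]_d * 'rV[R]_d => p.2 - p.1)); last first.
  by apply/funext => p; exact: kernel_translate kg p.1 p.2.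
by apply: measurableT_comp; [exact: (kernel_measurable kg)|exact: measurable_rV_sub].
Qed.

Lemma integral_kernel_at (F : 'rV[R]_d -> R) (x : 'rV[R]_d) : measurable_fun setT F ->
  (\int[lebesgue_rV]_y (F y * g x y)%:E = \int[lebesgue_rV]_z (F (z + x)%R * k z)%:E)%E.
Proof.
move=> mF; rewrite -(@integral_translate R d x (fun y => (F y * g x y)%:E)).
  by apply: eq_integral => z _; rewrite (kernel_translate kg x) addrK.
by apply/measurable_EFinP/measurable_funM => //; exact: measurable_kernel_at.
Qed.

Lemma integrable_kernel_at (F : 'rV[R]_d -> R) (C : R) (x : 'rV[R]_d) :
    measurable_fun setT F ->
  (forall y, enorm (y - x) < delta -> `|F y| <= C) ->
  lebesgue_rV.-integrable setT (EFin \o (fun y => F y * g x y)).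
Proof.
move=> mF FC.
have mF' : measurable_fun setT (fun z : 'rV[R]_d => F (z + x)).
  by apply: measurableT_comp => //; exact: measurable_rV_translate.
have h := integrable_mul_kernel kg g_fin mF' (C := C).
have {}h := integrable_translate (- x) (h (fun z zd => FC (z + x) (ltac:(by rewrite
    addrK)))).
apply: eq_integrable h => // y _ /=.
by rewrite subrK (kernel_translate kg x).
Qed.

Lemma integrable_kernel_slice x : lebesgue_rV.-integrable setT (EFin \o g x).
Proof.
have h : lebesgue_rV.-integrable setT (EFin \o (fun y => 1 * g x y)).
  by apply: (@integrable_kernel_at (fun=> 1) 1) => // y _; rewrite normr1.
by apply: eq_integrable h => // y _ /=; rewrite mul1r.
Qed.

Lemma kernel_mass_at x : \int[lebesgue_rV]_y g x y = m.
Proof.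
congr fine; transitivity (\int[lebesgue_rV]_y (1 * g x y)%:E)%E.
  by apply: eq_integral => y _; rewrite mul1r.
rewrite (@integral_kernel_at (fun=> 1))//.
by apply: eq_integral => y _; rewrite mul1r.
Qed.

(** In the expansion of |z + y|^2 the term linear in z integrates to 0 and the quadratic one to
    d. *)
Lemma barrier_integral0 (C : R) y :
  \int[lebesgue_rV]_z ((C - enorm (z + y) ^+ 2) * k z) = (C - enorm y ^+ 2) * m - d%:R.
Proof.
have ik := integrable_kernel kg g_fin.
have i1 i : lebesgue_rV.-integrable setT (EFin \o (fun z : 'rV[R]_d => z ord0 i * k z)).
  apply: (integrable_mul_kernel kg g_fin (C := delta)); first exact: measurable_coord.
  by move=> z zd; rewrite (le_trans (enorm_coord z i))// ltW.
have i1' i : lebesgue_rV.-integrable setT (EFin \o (fun z : 'rV[R]_d => 2 * y ord0 i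
    * (z ord0 i * k z))).
  exact: (integrableZl measurableT _ (i1 i)).
have isum : lebesgue_rV.-integrable setT (EFin \o (fun z : 'rV[R]_d => \sum_i 2 * y
    ord0 i * (z ord0 i * k z))).
  rewrite (_ : _ \o _ = fun z : 'rV[R]_d => (\sum_i (2 * y ord0 i * (z ord0 i * k
      z))%:E)%E).
    by apply: integrable_sum => // i _; exact: i1'.
  by apply/funext => z /=; rewrite sumEFin.
have i2 : lebesgue_rV.-integrable setT (EFin \o (fun z : 'rV[R]_d => enorm z ^+ 2 * k z)).
  apply: (integrable_mul_kernel kg g_fin (C := delta ^+ 2)).
    by apply: measurable_funX; exact: measurable_enorm.
  move=> z zd; rewrite ger0_norm ?sqr_ge0//; apply: lerXn2r; rewrite ?nnegrE ?enorm_ge0//.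
    by rewrite (le_trans (enorm_ge0 z))// ltW.
  exact: ltW.
rewrite (_ : (fun z => _) = (fun z : 'rV[R]_d => (C - enorm y ^+ 2) * k z -
   (\sum_i 2 * y ord0 i * (z ord0 i * k z) + enorm z ^+ 2 * k z))); last first.
  apply/funext => z; rewrite !sqr_enorm.
  have -> : \sum_i (z + y) ord0 i ^+ 2 = \sum_i z ord0 i ^+ 2 + \sum_i 2 * y ord0 i *
      z ord0 i + \sum_i y ord0 i ^+ 2.
    by rewrite -!big_split/=; apply: eq_bigr => i _; rewrite mxE; ring.
  have -> : \sum_i 2 * y ord0 i * (z ord0 i * k z) = (\sum_i 2 * y ord0 i * z ord0 i)
      * k z.
    by rewrite mulr_suml; apply: eq_bigr => i _; rewrite mulrA.
  by ring.
have ic : lebesgue_rV.-integrable setT (EFin \o (fun z => (C - enorm y ^+ 2) * k z)).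
  exact: (integrableZl measurableT _ ik).
rewrite RintegralB//; last first.
  exact: (integrableD measurableT isum i2).
rewrite RintegralZl// RintegralD// Rintegral_sum// big1 ?add0r; last first.
  by move=> i _; rewrite RintegralZl// (kernel_first_moment kg g_fin) mulr0.
by rewrite {2}/Rintegral (kernel_second_moment_enorm kg).
Qed.

Lemma integrable_barrier (C : R) (x : 'rV[R]_d) :
  lebesgue_rV.-integrable setT (EFin \o (fun y => (C - enorm y ^+ 2) * g x y)).
Proof.
apply: (@integrable_kernel_at _ (`|C| + (\sum_(i < d) (`|x ord0 i| + delta) ^+ 2))).
  by apply: measurable_funB => //; apply: measurable_funX; exact: measurable_enorm.
move=> y yx; rewrite (le_trans (ler_normB _ _))// lerD2l.
rewrite ger0_norm ?sqr_ge0// sqr_enorm; apply: ler_sum => i _.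
rewrite -real_normK ?num_real//; apply: lerXn2r; rewrite ?nnegrE//.
  by rewrite addr_ge0// (le_trans (enorm_ge0 (y - x)))// ltW.
have := enorm_coord (y - x) i; rewrite !mxE => h.
have := ler_normD (y ord0 i - x ord0 i) (x ord0 i); rewrite subrK.
lra.
Qed.

Lemma barrier_integral (C : R) (x : 'rV[R]_d) :
  \int[lebesgue_rV]_y ((C - enorm y ^+ 2) * g x y) = (C - enorm x ^+ 2) * m - d%:R.
Proof.
rewrite -barrier_integral0 /Rintegral; congr fine; apply: integral_kernel_at.
by apply: measurable_funB => //; apply: measurable_funX; exact: measurable_enorm.
Qed.

(** The normalisation forbids a vanishing mass: the second moment d would be at most delta^2 m =
    0. *)
Lemma kernel_mass_gt0 : 0 < m.
Proof.
rewrite lt_neqAle Rintegral_ge0 ?andbT; last by move=> z _; exact: (kernel_ge0 kg).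
apply/eqP => m0; have := barrier_integral0 0 0.
rewrite -m0 mulr0 sub0r.
have ik := integrable_kernel kg g_fin.
have i2 : lebesgue_rV.-integrable setT (EFin \o (fun z : 'rV[R]_d => (- delta ^+ 2) *
    k z)).
  exact: (integrableZl measurableT _ ik).
move=> h; have : \int[lebesgue_rV]_(z in [set: 'rV[R]_d]) ((- delta ^+ 2) * k z) <= -
    d%:R.
  rewrite -h; apply: le_Rintegral => //.
    have := integrable_barrier 0 0; apply: eq_integrable => // z _ /=.
    by rewrite addr0.
  move=> z _; rewrite addr0 sub0r.
  have [zd|dz] := ltP (enorm z) delta; last by rewrite (kernel_eq0 kg)// !mulr0.
  rewrite ler_wpM2r ?(kernel_ge0 kg)// lerN2; apply: lerXn2r; rewrite ?nnegrE
      ?enorm_ge0//.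
    by rewrite (le_trans (enorm_ge0 z))// ltW.
  exact: ltW.
by rewrite RintegralZl// -m0 mulr0 oppr_ge0 leNgt ltr0n.
Qed.

End kernel_integrals.

Section maximum_principle.
Context {R : realType} (n : nat) (delta : R) (g : 'rV[R]_n.+1 -> 'rV[R]_n.+1 -> R).
Hypothesis kg : kernel_conditions delta g.
Hypothesis g_fin : (\int[lebesgue_rV]_z (g 0 z)%:E < +oo)%E.
Local Notation k := (g 0).
Local Notation d := n.+1.
Local Notation m := (\int[lebesgue_rV]_(z in [set: 'rV[R]_d]) k z).
Variable Omega : set 'rV[R]_d.
Hypothesis oO : open Omega.
Hypothesis bO : exists M, ext_domain Omega delta `<=` cube M.
Local Notation D := (ext_domain Omega delta).

Lemma kernel_outside x y : Omega x -> ~ D y -> g x y = 0.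
Proof.
move=> Ox nDy; apply: (kernel_support kg) => yx.
by apply: nDy; exact: eball_ext_domain oO Ox yx.
Qed.

(* As v is merely integrable its supremum need not be attained.  Instead, the
   positive part p of v, extended by 0 off Omega, satisfies
   m p(x) <= int p(y) g(x, y) dy; testing this with Phi = C - |x|^2 >= 0, for
   which int Phi(y) g(x, y) dy = m Phi(x) - d, gives d int p <= 0. *)
Lemma nonlocal_maximum_principle (v : 'rV[R]_d -> R) :
  lebesgue_rV.-integrable D (EFin \o v) ->
  (forall x, Omega x -> lebesgue_rV.-integrable setT (fun y => ((v y - v x) * g x
      y)%:E)) ->
  (forall x, Omega x -> 0 <= \int[lebesgue_rV]_y ((v y - v x) * g x y)) ->
  (forall y, collar Omega delta y -> v y <= 0) ->
  forall x, Omega x -> v x <= 0.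
Proof.
move=> iv ivx Lv vc.
have mO : measurable Omega by exact: open_measurable_rV.
have mD : measurable D by apply: open_measurable_rV; exact: open_ext_domain.
have [M DM] := bO.
pose p : 'rV[R]_d -> R := (fun y => Num.max (v y) 0) \_ Omega.
have p0 y : 0 <= p y.
  by rewrite /p patchE; case: ifP => // _; rewrite le_max lexx orbT.
have ivO : lebesgue_rV.-integrable Omega (EFin \o v).
  by apply: integrableS iv => // y Oy; left.
have mp : measurable_fun setT p.
  apply/(measurable_restrictT _ _).1 => //; apply: measurable_maxr => //.
  by apply/measurable_EFinP; exact: measurable_int ivO.
have ip : lebesgue_rV.-integrable setT (EFin \o p).
  rewrite (_ : EFin \o p = (EFin \o (fun y => Num.max (v y) 0)) \_ Omega); last first.
    by apply/funext => y; rewrite /= /p !patchE; case: ifP.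
  apply/(integrable_mkcond _ mO); apply: le_integrable (ivO) => //.
    apply/measurable_EFinP/measurable_maxr => //.
    by apply/measurable_EFinP; exact: measurable_int ivO.
  move=> y _ /=; rewrite lee_fin; case: (leP (v y) 0) => vy; last by [].
  by rewrite normr0.
have ik := integrable_kernel_slice kg g_fin.
(* Where v(x) > 0, the sign of the operator gives m v(x) <= int v(y) g(x, y) dy, and v <= p wherever
   g(x, .) is nonzero because v <= 0 on the collar. *)
have sub x : Omega x -> ((p x * m)%:E <= \int[lebesgue_rV]_y (p y * g x y)%:E)%E.
  move=> Ox.
  have [vx|vx] := leP (v x) 0.
    rewrite /p patchE mem_set// max_r// mul0r; apply: integral_ge0 => y _.
    by rewrite lee_fin mulr_ge0//; exact: (kernel_ge0 kg).
  rewrite {1}/p patchE mem_set// max_l ?(ltW vx)//.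
  have ivg : lebesgue_rV.-integrable setT (EFin \o (fun y => v y * g x y)).
    have h := integrableD measurableT (ivx x Ox) (integrableZl measurableT (v x) (ik x)).
    apply: eq_integrable h => // y _ /=.
    by rewrite -EFinM -EFinD; congr EFin; ring.
  have E : \int[lebesgue_rV]_y (v y * g x y) =
      \int[lebesgue_rV]_y ((v y - v x) * g x y) + v x * m.
    rewrite -(kernel_mass_at kg x) -RintegralZl// -RintegralD//.
    - by apply: eq_Rintegral => y _; ring.
    - exact: ivx.
    - exact: (integrableZl measurableT (v x) (ik x)).
  have le1 : v x * m <= \int[lebesgue_rV]_y (v y * g x y) by rewrite E lerDr Lv.
  have pg y : `|p y * g x y| <= `|v y * g x y|.
    rewrite !normrM ler_wpM2r// (ger0_norm (p0 y)) /p patchE.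
    case: ifPn => // _; case: (leP (v y) 0) => vy; rewrite ?normr_ge0 ?ler_norm//.
  have ipg : lebesgue_rV.-integrable setT (EFin \o (fun y => p y * g x y)).
    apply: le_integrable (ivg) => //.
      by apply/measurable_EFinP/measurable_funM => //; exact: (measurable_kernel_at kg).
    by move=> y _ /=; rewrite lee_fin.
  apply: (@le_trans _ _ (\int[lebesgue_rV]_y (v y * g x y))%:E); first by rewrite lee_fin.
  rewrite fineK ?integrable_fin_num//; apply: le_integral => // y _ /=.
  rewrite lee_fin.
  have [Dy|nDy] := pselect (D y); last by rewrite (kernel_outside Ox nDy) !mulr0.
  rewrite ler_wpM2r ?(kernel_ge0 kg)// /p patchE.
  case: ifPn => [_|/negP nOy]; first by rewrite le_max lexx.
  by apply: vc; case: Dy => // Oy; exfalso; apply: nOy; exact: mem_set.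
(* On the cube |y|^2 <= d M^2, which makes [Phi] nonnegative on the extended domain. *)
pose C := \sum_(i < d) M ^+ 2.
pose Phi (y : 'rV[R]_d) := C - enorm y ^+ 2.
have Phi0 y : D y -> 0 <= Phi y.
  move=> /DM yM; rewrite subr_ge0 sqr_enorm; apply: ler_sum => i _.
  have := yM i; rewrite /= in_itv/= -ltr_norml => h.
  by rewrite -real_normK ?num_real//; apply: lerXn2r; rewrite ?nnegrE// ltW//
      (le_lt_trans _ h).
have PhiC y : Phi y <= C by rewrite /Phi gerBl sqr_ge0.
have mPhi : measurable_fun setT Phi.
  by apply: measurable_funB => //; apply: measurable_funX; exact: measurable_enorm.
have m0 : 0 < m by exact: (kernel_mass_gt0 kg g_fin).
(* [Phi] is negative far away. Cut to Omega, where [p] lives, it has the same product with [p] and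
   is nonnegative, as Tonelli's theorem requires. *)
pose q : 'rV[R]_d -> R := Phi \_ Omega.
have q0 y : 0 <= q y by rewrite /q patchE; case: ifPn => // /set_mem Oy; apply: Phi0;
    left.
have mq : measurable_fun setT q.
  by apply/(measurable_restrictT _ _).1 => //; exact: measurable_funTS.
have qpE y : q y * p y = Phi y * p y.
  by rewrite /q /p !patchE; case: ifP; rewrite // !mulr0.
have iqp : lebesgue_rV.-integrable setT (EFin \o (fun y => q y * p y)).
  apply: le_integrable (integrableZl measurableT C ip) => //.
    by apply/measurable_EFinP; exact: measurable_funM.
  move=> y _ /=; rewrite lee_fin !ger0_norm ?mulr_ge0// ?(le_trans (q0 y))//.
    rewrite ler_wpM2r// /q patchE; case: ifP => // _.
    by rewrite /C sumr_ge0// => i _; rewrite sqr_ge0.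
  by rewrite /q patchE; case: ifP => // _; rewrite /C sumr_ge0// => i _; rewrite sqr_ge0.
pose A := \int[lebesgue_rV]_(y in [set: 'rV[R]_d]) (q y * p y).
pose P := \int[lebesgue_rV]_(y in [set: 'rV[R]_d]) p y.
(* [sub] is multiplied by q(x) and integrated in x, and the two integrals are exchanged. *)
have key : ((A * m)%:E <= (A * m - d%:R * P)%:E)%E.
  have mqpg : measurable_fun setT (fun xy : 'rV[R]_d * 'rV[R]_d => (q xy.1 * (p xy.2
      * g xy.1 xy.2))%:E).
    apply/measurable_EFinP; apply: measurable_funM.
      by apply: measurableT_comp => //; exact: measurable_fst.
    apply: measurable_funM; last exact: (measurable_kernel2 kg).
    by apply: measurableT_comp => //; exact: measurable_snd.
  have qpg0 (xy : 'rV[R]_d * 'rV[R]_d) : (0 <= (q xy.1 * (p xy.2 * g xy.1 xy.2))%:E)%E.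
    by rewrite lee_fin !mulr_ge0//; exact: (kernel_ge0 kg).
  apply: (@le_trans _ _ (\int[lebesgue_rV]_x \int[lebesgue_rV]_y (q x * (p y * g x
      y))%:E)%E).
    have -> : (A * m)%:E = (\int[lebesgue_rV]_x (q x * p x * m)%:E)%E.
      rewrite -RintegralZr// fineK//; apply: integrable_fin_num => //.
      exact: (integrableZr measurableT m iqp).
    apply: ge0_le_integral => //.
    - by move=> x _; rewrite lee_fin !mulr_ge0// ltW.
    - apply/measurable_EFinP; apply: measurable_funM => //; exact: measurable_funM.
    - exact: (measurable_fun_fubini_tonelli_F (fun xy : 'rV[R]_d * 'rV[R]_d => (q
        xy.1 * (p xy.2 * g xy.1 xy.2))%:E) mqpg).
    - move=> x _; under eq_integral do rewrite EFinM.
      rewrite ge0_integralZl_EFin//.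
      + rewrite -mulrA EFinM; have [Ox|nOx] := pselect (Omega x).
          by apply: lee_wpmul2l; [rewrite lee_fin|exact: sub].
        by rewrite /q patchE memNset// !mul0e.
      + by move=> y _; rewrite lee_fin mulr_ge0//; exact: (kernel_ge0 kg).
      + by apply/measurable_EFinP/measurable_funM => //; exact: (measurable_kernel_at kg).
  rewrite (fubini_tonelli (fun xy : 'rV[R]_d * 'rV[R]_d => (q xy.1 * (p xy.2 * g xy.1
      xy.2))%:E))//=.
  have -> : (A * m - d%:R * P)%:E = (\int[lebesgue_rV]_y (q y * p y * m - d%:R * p
      y)%:E)%E.
    rewrite -RintegralZr// -[d%:R * P]RintegralZl// -RintegralB//.
    - rewrite fineK//; apply: integrable_fin_num => //.
      exact: (integrableB measurableT (integrableZr measurableT m iqp) (integrableZl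
          measurableT d%:R ip)).
    - exact: (integrableZr measurableT m iqp).
    - exact: (integrableZl measurableT d%:R ip).
  (* For y in Omega, g(x, y) vanishes unless x is in the extended domain, where q <= Phi; by
     symmetry of the kernel the barrier identity at y applies. *)
  have inner y : (\int[lebesgue_rV]_x (q x * (p y * g x y))%:E <= (q y * p y * m -
      d%:R * p y)%:E)%E.
    have [Oy|nOy] := pselect (Omega y); last first.
      rewrite (_ : p y = 0); last by rewrite /p patchE memNset.
      rewrite !mulr0 mul0r subr0; under eq_integral do rewrite mul0r mulr0.
      by rewrite integral0.
    under eq_integral do rewrite mulrCA EFinM.
    rewrite ge0_integralZl_EFin//; last 2 first.
    - by move=> x _; rewrite lee_fin mulr_ge0//; exact: (kernel_ge0 kg).
    - apply/measurable_EFinP/measurable_funM => //.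
      under eq_fun do rewrite (kernel_sym kg); exact: (measurable_kernel_at kg).
    rewrite qpE mulrAC -mulrBl [X in (_ <= X%:E)%E]mulrC EFinM; apply: lee_wpmul2l;
        first by rewrite lee_fin.
    rewrite -(barrier_integral kg g_fin) fineK; last first.
      by apply: integrable_fin_num => //; exact: (integrable_barrier kg g_fin).
    apply: ge0_le_integral => //.
    - by move=> x _; rewrite lee_fin mulr_ge0//; exact: (kernel_ge0 kg).
    - apply/measurable_EFinP/measurable_funM => //.
      under eq_fun do rewrite (kernel_sym kg); exact: (measurable_kernel_at kg).
    - by apply/measurable_EFinP/measurable_funM => //; exact: (measurable_kernel_at kg).
    move=> x _; rewrite lee_fin (kernel_sym kg x y).
    have [Dx|nDx] := pselect (D x); last by rewrite (kernel_outside Oy nDx) !mulr0.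
    rewrite ler_wpM2r ?(kernel_ge0 kg)// /q patchE; case: ifP => // _.
    exact: Phi0.
  apply: ge0_le_integral => //.
  - by move=> y _; apply: integral_ge0 => x _; exact: (qpg0 (x, y)).
  - exact: (measurable_fun_fubini_tonelli_G (fun xy : 'rV[R]_d * 'rV[R]_d => (q xy.1
      * (p xy.2 * g xy.1 xy.2))%:E) mqpg).
  - apply/measurable_EFinP; apply: measurable_funB; last exact: measurable_funM.
    by apply: measurable_funM => //; exact: measurable_funM.
have P0 : P <= 0.
  by move: key; rewrite lee_fin -subr_ge0 addrAC subrr sub0r oppr_ge0 pmulr_rle0// ltr0n.
have PE : (\int[lebesgue_rV]_y `|(p y)%:E| = 0)%E.
  transitivity P%:E; last by congr EFin; apply/eqP; rewrite eq_le P0 Rintegral_ge0.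
  rewrite fineK; last by apply: integrable_fin_num.
  by apply: eq_integral => y _; rewrite gee0_abs// lee_fin.
have pae : ae_eq lebesgue_rV setT (EFin \o p) (cst 0%E).
  by apply/(ae_eq_integral_abs _ measurableT) => //; exact/measurable_EFinP.
(* So far [p] vanishes only almost everywhere; [sub] upgrades this to every point, since m p(x) is
   at most an integral that is now 0. *)
move=> x Ox; have := sub x Ox.
rewrite (_ : (\int[_]_y _)%E = 0%E); last first.
  transitivity (\int[lebesgue_rV]_(y in [set: 'rV[R]_d]) (cst 0 y))%E; last exact:
      integral0.
  apply: ae_eq_integral => //.
    by apply/measurable_EFinP/measurable_funM => //; exact: (measurable_kernel_at kg).
  by apply: filterS pae => y /(_ I)/= [->]; rewrite mul0r.
rewrite lee_fin pmulr_lle0// /p patchE mem_set//.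
by apply: le_trans; rewrite le_max lexx.
Qed.

End maximum_principle.

(** * Consistency and error estimates *)

Lemma Cb_measurable (R : realType) (d n : nat) (D : set 'rV[R]_d) (f : 'rV[R]_d -> R) :
  open D -> Cb n D f -> measurable_fun D f.
Proof.
move=> oD fD.
have cf : {in D, continuous f}.
  by move=> x /set_mem Dx; exact: Cb_continuous oD fD Dx.
apply: (measurability _ (RGenOpens.measurableE R)) => _ [_ [a [b ->] <-]].
by apply: open_measurable_rV; apply: (continuous_inP _ oD).1 => //; exact: interval_open.
Qed.

Lemma Cb_bounded (R : realType) (d n : nat) (D : set 'rV[R]_d) (f : 'rV[R]_d -> R) :
  Cb n D f -> exists2 B : R, 0 <= B & forall x, D x -> `|f x| <= B.
Proof.
move=> fD; have [M [_ fM]] : [bounded f x | x in D] by case: n fD => [|n] [].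
exists (`|M| + 1); first by rewrite addr_ge0.
by move=> x Dx; apply: fM => //; rewrite (le_lt_trans (ler_norm M))// ltrDl.
Qed.

Section consistency.
Context {R : realType} (n : nat) (delta : R) (g : 'rV[R]_n.+1 -> 'rV[R]_n.+1 -> R).
Hypothesis kg : kernel_conditions delta g.
Hypothesis g_fin : (\int[lebesgue_rV]_z (g 0 z)%:E < +oo)%E.
Local Notation k := (g 0).
Local Notation d := n.+1.
Variables (D : set 'rV[R]_d) (U : 'rV[R]_d -> R).
Hypotheses (oD : open D) (UD : Cb 4 D U).

(** Off [D] the values of [U] are arbitrary, so [U] is replaced by its restriction extended by 0,
    which changes nothing where the kernel is nonzero. *)
Lemma integrable_smooth_difference x : (forall y, enorm (y - x) < delta -> D y) ->
  lebesgue_rV.-integrable setT (EFin \o (fun y => (U y - U x) * g x y)).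
Proof.
move=> xD; have [B B0 UB] := Cb_bounded UD.
have mD : measurable D by exact: open_measurable_rV.
have mU : measurable_fun setT (U \_ D).
  by apply/(measurable_restrictT _ _).1 => //; exact: Cb_measurable oD UD.
have UB' y : `|(U \_ D) y| <= B.
  by rewrite patchE; case: ifPn => [/set_mem/UB//|_]; rewrite normr0.
have h : lebesgue_rV.-integrable setT (EFin \o (fun y => ((U \_ D) y - U x) * g x y)).
  apply: (integrable_kernel_at kg g_fin (C := B + `|U x|)); first exact: measurable_funB.
  by move=> y _; rewrite (le_trans (ler_normB _ _))// lerD2r.
apply: eq_integrable h => // y _ /=; congr EFin.
have [yx|yx] := ltP (enorm (y - x)) delta; first by rewrite patchE mem_set//; exact: xD.
by rewrite (kernel_translate kg) (kernel_eq0 kg)// !mulr0.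
Qed.

(** The factor 2 of [nonlocal_op] pays for adding the contributions of z and -z, which are equal;
    this produces the second differences of [symmetric_taylor]. *)
Lemma integral_symmetrize (F : 'rV[R]_d -> R) x : measurable_fun setT F ->
  lebesgue_rV.-integrable setT (EFin \o (fun y => F y * g x y)) ->
  2 * \int[lebesgue_rV]_y (F y * g x y) =
  \int[lebesgue_rV]_z ((F (z + x) + F (- z + x)) * k z) /\
  lebesgue_rV.-integrable setT (EFin \o (fun z => (F (z + x) + F (- z + x)) * k z)).
Proof.
move=> mF iF.
have mF' : measurable_fun setT (fun z : 'rV[R]_d => F (z + x)).
  by apply: measurableT_comp => //; exact: measurable_rV_translate.
have kN z : k (- z) = k z by apply: (kernel_enorm kg); exact: enormN.
have i1 : lebesgue_rV.-integrable setT (EFin \o (fun z => F (z + x) * k z)).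
  have h := integrable_translate x iF.
  by apply: eq_integrable h => // z _ /=; rewrite (kernel_translate kg x) addrK.
have i2 : lebesgue_rV.-integrable setT (EFin \o (fun z => F (- z + x) * k z)).
  have h := integrable_reflect 0 i1.
  by apply: eq_integrable h => // z _ /=; rewrite sub0r kN.
have E1 : \int[lebesgue_rV]_y (F y * g x y) = \int[lebesgue_rV]_z (F (z + x) * k z).
  by congr fine; exact: (integral_kernel_at kg).
have E2 : \int[lebesgue_rV]_y (F y * g x y) = \int[lebesgue_rV]_z (F (- z + x) * k z).
  rewrite E1; congr fine; rewrite -(@integral_reflect R d 0 (fun z => (F (z + x) * k
      z)%:E)).
    by apply: eq_integral => z _; rewrite sub0r kN.
  by apply: (measurable_int lebesgue_rV); exact: i1.
have isum : lebesgue_rV.-integrable setT (EFin \o (fun z => F (z + x) * k z + F (- z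
    + x) * k z)).
  exact: (integrableD measurableT i1 i2).
split.
  rewrite mulr_natl mulr2n {1}E1 E2 -RintegralD//.
  by apply: eq_Rintegral => z _; rewrite mulrDl.
by apply: eq_integrable isum => // z _ /=; rewrite mulrDl.
Qed.

(** The remainder is at most 2 M4 d^4 |z|^4, the l^1 norm costing d^4. On the support one factor
    |z|^2 is traded for delta^2, and the second moment of the other supplies the fifth power of
    d. *)
Lemma nonlocal_consistency (M4 : R) x : 0 <= M4 ->
  (forall y z, D y -> `|dir_derive 4 z U y| <= M4 * (\sum_i `|z ord0 i|) ^+ 4) ->
  (forall y, enorm (y - x) < delta -> D y) -> 0 < delta ->
  `|nonlocal_op g U x - laplacian U x| <= 2 * M4 * d%:R ^+ 5 * delta ^+ 2.
Proof.
move=> M40 UM xD d0.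
have mD : measurable D by exact: open_measurable_rV.
have mU : measurable_fun setT (U \_ D).
  by apply/(measurable_restrictT _ _).1 => //; exact: Cb_measurable oD UD.
have Dx : D x by apply: xD; rewrite subrr enorm0.
pose F y := (U \_ D) y - U x.
have FE y : (U y - U x) * g x y = F y * g x y.
  have [yx|yx] := ltP (enorm (y - x)) delta; first by rewrite /F patchE mem_set//;
      exact: xD.
  by rewrite (kernel_translate kg) (kernel_eq0 kg)// !mulr0.
have mF : measurable_fun setT F by exact: measurable_funB.
have iF : lebesgue_rV.-integrable setT (EFin \o (fun y => F y * g x y)).
  by apply: eq_integrable (integrable_smooth_difference xD) => // y _ /=; rewrite FE.
have [SE iS] := integral_symmetrize mF iF.
pose H i j := partial j (partial i U) x.
have QE z : dir_derive 2 z U x = \sum_i \sum_j H i j * (z ord0 i * z ord0 j).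
  apply: eq_bigr => i _; rewrite /= mulr_sumr; apply: eq_bigr => j _.
  by rewrite /H; ring.
have i2 i j : lebesgue_rV.-integrable setT (EFin \o (fun z : 'rV[R]_d => H i j * (z
    ord0 i * z ord0 j * k z))).
  exact: (integrableZl measurableT _ (integrable_second_moment kg g_fin i j)).
have iQ : lebesgue_rV.-integrable setT (EFin \o (fun z => dir_derive 2 z U x * k z)).
  rewrite (_ : _ \o _ = fun z : 'rV[R]_d => (\sum_i \sum_j (H i j * (z ord0 i * z
      ord0 j * k z))%:E)%E).
    by apply: integrable_sum => // i _; apply: integrable_sum => // j _; exact: i2.
  apply/funext => z; rewrite /comp QE mulr_suml -sumEFin; apply: eq_bigr => i _.
  by rewrite mulr_suml -sumEFin; apply: eq_bigr => j _; rewrite -!mulrA.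
have LE : laplacian U x = \int[lebesgue_rV]_z (dir_derive 2 z U x * k z).
  rewrite (_ : laplacian U x = \sum_i H i i)// -(kernel_quadratic_moment kg g_fin H).
  by apply: eq_Rintegral => z _; rewrite QE.
have -> : nonlocal_op g U x - laplacian U x = \int[lebesgue_rV]_z
    ((F (z + x) + F (- z + x)) * k z - dir_derive 2 z U x * k z).
  rewrite RintegralB// -SE LE /nonlocal_op; congr (2 * _ - _).
  by apply: eq_Rintegral => y _; exact: FE.
have iD : lebesgue_rV.-integrable setT (EFin \o (fun z => (F (z + x) + F (- z + x)) *
    k z - dir_derive 2 z U x * k z)).
  exact: (integrableB measurableT iS iQ).
rewrite (le_trans (le_normr_Rintegral _ _))//.
pose c := 2 * M4 * d%:R ^+ 4 * delta ^+ 2.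
have i2' : lebesgue_rV.-integrable setT (EFin \o (fun z : 'rV[R]_d => enorm z ^+ 2 *
    k z)).
  apply/integrableP; split.
    apply/measurable_EFinP/measurable_funM; last exact: (kernel_measurable kg).
    by apply: measurable_funX; exact: measurable_enorm.
  rewrite (_ : (\int[_]_(_ in _) _)%E = (d%:R)%:E) ?ltry//.
  rewrite -(kernel_second_moment_enorm kg); apply: eq_integral => z _ /=.
  by rewrite ger0_norm// mulr_ge0 ?sqr_ge0// (kernel_ge0 kg).
have -> : 2 * M4 * d%:R ^+ 5 * delta ^+ 2 = \int[lebesgue_rV]_z (c * (enorm (z :
    'rV[R]_d) ^+ 2 * k z)).
  rewrite RintegralZl// [X in _ = _ * X]/Rintegral (kernel_second_moment_enorm kg).
  by rewrite /c/=; ring.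
apply: le_Rintegral => //.
- exact: integrable_norm iD.
- exact: (integrableZl measurableT _ i2').
move=> z _; rewrite -mulrBl normrM (ger0_norm (kernel_ge0 kg _ _)) mulrA.
have [zd|zd] := ltP (enorm z) delta; last by rewrite (kernel_eq0 kg)// !mulr0.
rewrite ler_wpM2r ?(kernel_ge0 kg)//.
have Dz (t : R) : `|t| <= 1 -> D (t *: z + x).
  by move=> t1; apply: xD; rewrite addrK enormZ (le_lt_trans _ zd)// ler_piMl ?enorm_ge0.
have s0 : 0 <= \sum_(i < d) `|z ord0 i| by rewrite sumr_ge0.
have sz : \sum_(i < d) `|z ord0 i| <= d%:R * enorm z.
  rewrite mulr_natl -[X in _ *+ X](card_ord d) -sumr_const; apply: ler_sum => i _.
  exact: enorm_coord.
have T := symmetric_taylor oD UD Dz (fun y Dy => UM y z Dy).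
have -> : F (z + x) + F (- z + x) - dir_derive 2 z U x = U (z + x) + U (- z + x) - 2
    * U x - dir_derive 2 z U x.
  rewrite /F !patchE !mem_set; first by ring.
    by have := Dz (-1); rewrite scaleN1r normrN normr1; exact.
  by have := Dz 1; rewrite scale1r normr1; exact.
apply: le_trans T _.
apply: (@le_trans _ _ (2 * (M4 * (d%:R * enorm z) ^+ 4))).
  rewrite ler_pM2l// ler_wpM2l//; apply: lerXn2r => //; rewrite nnegrE//.
  by rewrite mulr_ge0 ?enorm_ge0.
have e2 : enorm z ^+ 2 <= delta ^+ 2.
  by apply: lerXn2r; rewrite ?nnegrE ?enorm_ge0// ltW.
rewrite (_ : 2 * _ = (2 * M4 * d%:R ^+ 4 * enorm z ^+ 2) * enorm z ^+ 2); last by ring.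
rewrite ler_wpM2r ?sqr_ge0// /c ler_wpM2l// !mulr_ge0 ?exprn_ge0//.
Qed.

End consistency.

(** * Sup-norm bound by a quadratic barrier *)

Section error_bound.
Context {R : realType} (n : nat) (delta : R) (g : 'rV[R]_n.+1 -> 'rV[R]_n.+1 -> R).
Hypothesis kg : kernel_conditions delta g.
Hypothesis g_fin : (\int[lebesgue_rV]_z (g 0 z)%:E < +oo)%E.
Local Notation k := (g 0).
Local Notation d := n.+1.
Variable Omega : set 'rV[R]_d.
Hypothesis oO : open Omega.
Local Notation D := (ext_domain Omega delta).
Variable M : R.
Hypothesis DM : D `<=` cube M.

(** The barrier w = b + s (C - |y|^2) dominates e on the collar, and L w = -2 d s = -r makes L (e -
    w) >= 0, so the maximum principle gives e <= w <= b + s C. *)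
Lemma nonlocal_upper_bound (e : 'rV[R]_d -> R) (b r : R) : 0 <= r ->
  lebesgue_rV.-integrable D (EFin \o e) ->
  (forall x, Omega x -> lebesgue_rV.-integrable setT (fun y => ((e y - e x) * g x
      y)%:E)) ->
  (forall x, Omega x -> - r <= nonlocal_op g e x) ->
  (forall y, collar Omega delta y -> e y <= b) ->
  forall x, Omega x -> e x <= b + r / (2 * d%:R) * (d%:R * M ^+ 2).
Proof.
move=> r0 ie iex Le eb.
have mD : measurable D by apply: open_measurable_rV; exact: open_ext_domain.
have Dfin : (lebesgue_rV D < +oo)%E := lebesgue_rV_lty mD DM.
pose C := d%:R * M ^+ 2.
pose s := r / (2 * d%:R).
have s0 : 0 <= s by rewrite divr_ge0 ?mulr_ge0.
have sq y : D y -> enorm y ^+ 2 <= C.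
  move=> /DM yM; rewrite sqr_enorm /C mulr_natl -[X in _ *+ X](card_ord d) -sumr_const.
  apply: ler_sum => i _.
  have := yM i; rewrite /= in_itv/= -ltr_norml => h.
  by rewrite -real_normK ?num_real//; apply: lerXn2r; rewrite ?nnegrE// ltW//
      (le_lt_trans _ h).
pose w y := b + s * (C - enorm (y : 'rV[R]_d) ^+ 2).
pose v y := e y - w y.
have mw : measurable_fun setT w.
  apply: measurable_funD => //; apply: measurable_funM => //; apply: measurable_funB
      => //.
  by apply: measurable_funX; exact: measurable_enorm.
have iw : lebesgue_rV.-integrable D (EFin \o w).
  apply: measurable_bounded_integrable => //; first exact: measurable_funTS.
  exists (`|b| + s * C); split; first exact: num_real.
  move=> N hN y Dy /=; rewrite (le_trans _ (ltW hN))// (le_trans (ler_normD _ _))//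
      lerD2l.
  rewrite ger0_norm; last by rewrite mulr_ge0// subr_ge0 sq.
  by rewrite ler_wpM2l// gerBl sqr_ge0.
have ibar x : lebesgue_rV.-integrable setT (EFin \o (fun y => (C - enorm y ^+ 2) * g
    x y)).
  exact: (integrable_barrier kg g_fin).
have ik := integrable_kernel_slice kg g_fin.
have iphi x : lebesgue_rV.-integrable setT (EFin \o (fun y => (C - enorm y ^+ 2) * g
    x y - (C - enorm x ^+ 2) * g x y)).
  exact: (integrableB measurableT (ibar x) (integrableZl measurableT (C - enorm x ^+
      2) (ik x))).
have iwx x : lebesgue_rV.-integrable setT (EFin \o (fun y => s * ((C - enorm y ^+ 2)
    * g x y - (C - enorm x ^+ 2) * g x y))).
  exact: (integrableZl measurableT s (iphi x)).
have vE x y : (v y - v x) * g x y = (e y - e x) * g x y -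
    s * ((C - enorm y ^+ 2) * g x y - (C - enorm x ^+ 2) * g x y).
  by rewrite /v /w; ring.
have iv : lebesgue_rV.-integrable D (EFin \o v) by exact: (integrableB mD ie iw).
have key := @nonlocal_maximum_principle _ _ _ _ kg g_fin Omega oO (ex_intro _ M DM) v iv.
move=> x Ox.
have vx : v x <= 0.
  apply: key => // [{x Ox}x Ox|{x Ox}x Ox|y cy].
  - apply: eq_integrable (integrableB measurableT (iex x Ox) (iwx x)) => // y _ /=.
    by rewrite vE.
  - rewrite (@eq_Rintegral _ _ _ _ _ (fun y => (e y - e x) * g x y -
        s * ((C - enorm y ^+ 2) * g x y - (C - enorm x ^+ 2) * g x y))); last by
            move=> y _; exact: vE.
    rewrite RintegralB//; last exact: iex.
    rewrite RintegralZl// RintegralB//; last exact: (integrableZl measurableT _ (ik x)).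
    rewrite RintegralZl// (kernel_mass_at kg) (barrier_integral kg g_fin).
    have := Le x Ox; rewrite /nonlocal_op => h.
    have -> : s * ((C - enorm x ^+ 2) * Rintegral lebesgue_rV setT k - d%:R -
        (C - enorm x ^+ 2) * Rintegral lebesgue_rV setT k) = - (r / 2).
      have -> : r / 2 = s * d%:R.
        by rewrite /s invfM -!mulrA mulVf ?mulr1// pnatr_eq0.
      by ring.
    lra.
  - rewrite /v /w; have := eb y cy.
    have : 0 <= s * (C - enorm y ^+ 2) by rewrite mulr_ge0// subr_ge0 sq//; right.
    lra.
move: vx; rewrite /v /w subr_le0 => /le_trans; apply.
by rewrite lerD2l ler_wpM2l// gerBl sqr_ge0.
Qed.

Lemma nonlocal_error_bound (e : 'rV[R]_d -> R) (b r : R) : 0 <= r ->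
  lebesgue_rV.-integrable D (EFin \o e) ->
  (forall x, Omega x -> lebesgue_rV.-integrable setT (fun y => ((e y - e x) * g x
      y)%:E)) ->
  (forall x, Omega x -> `|nonlocal_op g e x| <= r) ->
  (forall y, collar Omega delta y -> `|e y| <= b) ->
  forall x, Omega x -> `|e x| <= b + r / (2 * d%:R) * (d%:R * M ^+ 2).
Proof.
move=> r0 ie iex Le eb x Ox.
have ub : e x <= b + r / (2 * d%:R) * (d%:R * M ^+ 2).
  apply: nonlocal_upper_bound => // y => [/Le|/eb]; first by rewrite ler_norml => /andP[].
  by apply: le_trans; exact: ler_norm.
have ieN x' : Omega x' ->
    lebesgue_rV.-integrable setT (fun y => ((- e y - - e x') * g x' y)%:E).
  move=> Ox'; apply: eq_integrable (integrableN (iex x' Ox')) => // y _ /=.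
  by congr EFin; ring.
have lb : - e x <= b + r / (2 * d%:R) * (d%:R * M ^+ 2).
  apply: (@nonlocal_upper_bound (fun y => - e y)) => //.
  - exact: (integrableN ie).
  - move=> y Oy; rewrite (_ : nonlocal_op g (fun y => - e y) y = - nonlocal_op g e y).
      by rewrite lerN2; have := Le y Oy; rewrite ler_norml => /andP[].
    rewrite /nonlocal_op -mulrN; congr (2 * _).
    rewrite -mulN1r -RintegralZl//; last exact: iex.
    by apply: eq_Rintegral => z _; ring.
  - by move=> y /eb; apply: le_trans; rewrite -normrN ler_norm.
by rewrite ler_norml; apply/andP; split; [rewrite lerNl|].
Qed.

End error_bound.

(** * Energy estimate by nonlocal integration by parts *)

Section energy_bound.
Context {R : realType} (n : nat) (delta : R) (g : 'rV[R]_n.+1 -> 'rV[R]_n.+1 -> R).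
Hypothesis kg : kernel_conditions delta g.
Hypothesis g_fin : (\int[lebesgue_rV]_z (g 0 z)%:E < +oo)%E.
Local Notation k := (g 0).
Local Notation d := n.+1.
Local Notation m := (\int[lebesgue_rV]_(z in [set: 'rV[R]_d]) k z).
Variable Omega : set 'rV[R]_d.
Hypothesis oO : open Omega.
Local Notation D := (ext_domain Omega delta).
Variable M : R.
Hypothesis DM : D `<=` cube M.

(** Splitting the square into two mirror terms requires absolute integrability on the product, which
    follows from boundedness of [e], finite mass and finite volume of [D]. On Omega the inner
    integral is half of [nonlocal_op]; on the collar it is at most 2 E m. The mirror terms double
    the resulting E r / 2 and 2 b E m. *)
Lemma energy_bound (e : 'rV[R]_d -> R) (E b r : R) :
  0 <= E -> 0 <= b -> 0 <= r -> measurable_fun D e ->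
  (forall x, D x -> `|e x| <= E) ->
  (forall x, collar Omega delta x -> `|e x| <= b) ->
  (forall x, Omega x -> lebesgue_rV.-integrable setT (fun y => ((e y - e x) * g x
      y)%:E)) ->
  (forall x, Omega x -> `|nonlocal_op g e x| <= r) ->
  (\int[lebesgue_rV]_(x in D) \int[lebesgue_rV]_(y in D) ((e y - e x) ^+ 2 * g x y)%:E <=
   (E * r)%:E * lebesgue_rV Omega + (4 * b * E * m)%:E * lebesgue_rV (collar Omega
       delta))%E.
Proof.
move=> E0 b0 r0 me eE eb iex er.
have mD : measurable D by apply: open_measurable_rV; exact: open_ext_domain.
have mO : measurable Omega by exact: open_measurable_rV.
have mC : measurable (collar Omega delta) by exact: measurable_collar.
have Dfin : (lebesgue_rV D < +oo)%E := lebesgue_rV_lty mD DM.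
have m0 : 0 <= m by apply: Rintegral_ge0 => z _; exact: (kernel_ge0 kg).
(* [e] is measurable on [D] only: it is extended by 0, and the domain of integration moves into the
   weight [W]. *)
pose f : 'rV[R]_d -> R := e \_ D.
have mf : measurable_fun setT f by apply/(measurable_restrictT _ _).1.
have fE x : `|f x| <= E.
  by rewrite /f patchE; case: ifPn => [/set_mem/eE//|_]; rewrite normr0.
pose c : 'rV[R]_d -> R := \1_D.
have mc : measurable_fun setT c by exact: measurable_indic.
have c0 x : 0 <= c x by rewrite /c indicE.
have c1 x : c x <= 1 by rewrite /c indicE; case: (_ \in _).
pose W (p : 'rV[R]_d * 'rV[R]_d) := c p.1 * c p.2 * g p.1 p.2.
have W0 p : 0 <= W p by rewrite !mulr_ge0// (kernel_ge0 kg).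
have mW : measurable_fun setT W.
  apply: measurable_funM; last exact: (measurable_kernel2 kg).
  by apply: measurable_funM; apply: measurableT_comp.
(* F is the sum of H and of its mirror image Hs, which has the same integral. *)
pose H (p : 'rV[R]_d * 'rV[R]_d) := - f p.1 * (f p.2 - f p.1) * W p.
pose Hs (p : 'rV[R]_d * 'rV[R]_d) := - f p.2 * (f p.1 - f p.2) * W p.
pose F (p : 'rV[R]_d * 'rV[R]_d) := (f p.2 - f p.1) ^+ 2 * W p.
have mf1 : measurable_fun setT (fun p : 'rV[R]_d * 'rV[R]_d => f p.1).
  by apply: measurableT_comp => //; exact: measurable_fst.
have mf2 : measurable_fun setT (fun p : 'rV[R]_d * 'rV[R]_d => f p.2).
  by apply: measurableT_comp => //; exact: measurable_snd.
have mH : measurable_fun setT H.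
  apply: measurable_funM => //; apply: measurable_funM; last exact: measurable_funB.
  exact: measurable_funN.
have mHs : measurable_fun setT Hs.
  apply: measurable_funM => //; apply: measurable_funM; last exact: measurable_funB.
  exact: measurable_funN.
have mF : measurable_fun setT F.
  by apply: measurable_funM => //; apply: measurable_funX; exact: measurable_funB.
have Wsym x y : W (x, y) = W (y, x).
  by rewrite /W/= (kernel_sym kg x y) (mulrC (c x)).
have HsE x y : Hs (x, y) = H (y, x) by rewrite /Hs /H (Wsym x y).
have FE p : F p = H p + Hs p by rewrite /F /H /Hs; ring.
have fle (x : 'rV[R]_d) (B : R) y : `|f x| <= B -> `|f x * (f y - f x)| <= B * (2 * E).
  move=> fB; rewrite normrM ler_pM// (le_trans (ler_normB _ _))// mulr_natl mulr2n.
  by rewrite lerD.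
have ik := integrable_kernel_slice kg g_fin.
have gm x : (\int[lebesgue_rV]_y (g x y)%:E)%E = m%:E.
  by rewrite -(kernel_mass_at kg x) fineK// integrable_fin_num//; exact: ik.
have mg x : measurable_fun setT (g x) by exact: (measurable_kernel_at kg).
have mHx x : measurable_fun setT (fun y => H (x, y)).
  exact: (measurableT_comp mH (measurable_pair1 x)).
have intHx x B : `|f x| <= B -> (\int[lebesgue_rV]_y `|(H (x, y))%:E| <= (c x * (B *
    (2 * E) * m))%:E)%E.
  move=> fB.
  have -> : (c x * (B * (2 * E) * m))%:E = (\int[lebesgue_rV]_y ((c x * (B * (2 *
      E)))%:E * (g x y)%:E))%E.
    rewrite ge0_integralZl_EFin// ?gm -?EFinM ?mulrA//.
    - by move=> y _; rewrite lee_fin (kernel_ge0 kg).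
    - exact/measurable_EFinP.
    - by rewrite !mulr_ge0// (le_trans _ fB).
  apply: ge0_le_integral => //.
  - by apply: measurableT_comp => //; exact/measurable_EFinP.
  - by apply/measurable_EFinP; exact: measurable_funM.
  move=> y _; rewrite -EFinM lee_fin /H/= normrM mulNr normrN (ger0_norm (W0 _)) /W/=.
  have -> : c x * (B * (2 * E)) * g x y = B * (2 * E) * (c x * g x y) by ring.
  apply: ler_pM => //; [exact: (W0 (x, y))|exact: fle|].
  by rewrite ler_wpM2r ?(kernel_ge0 kg)// ler_piMr.
have iH : (lebesgue_rV \x lebesgue_rV)%E.-integrable setT (EFin \o H).
  apply/integrable12ltyP; first exact/measurable_EFinP.
  apply: (@le_lt_trans _ _ (\int[lebesgue_rV]_x ((E * (2 * E) * m)%:E * (\1_D x)%:E))%E).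
    apply: ge0_le_integral => //.
    - by move=> x _; exact: integral_ge0.
    - apply: (measurable_fun_fubini_tonelli_F (fun p => `|(H p)%:E|%E)).
      by apply: measurableT_comp => //; exact/measurable_EFinP.
      by [].
    - by apply: emeasurable_funM => //; exact/measurable_EFinP.
    - move=> x _; apply: le_trans (intHx x E (fE x)) _.
      by rewrite -EFinM mulrC.
  rewrite ge0_integralZl_EFin//; last 2 first.
  - by apply/measurable_EFinP.
  - by rewrite !mulr_ge0.
  by rewrite integral_indic// setIT lte_mul_pinfty// lee_fin !mulr_ge0.
have iHs : (lebesgue_rV \x lebesgue_rV)%E.-integrable setT (EFin \o Hs).
  apply/integrable21ltyP; first exact/measurable_EFinP.
  have mH' : measurable_fun setT (EFin \o H) by exact/measurable_EFinP.
  have h := (integrable12ltyP _ _ mH').1 iH.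
  rewrite (_ : (\int[_]_y _)%E =
    (\int[lebesgue_rV]_x \int[lebesgue_rV]_y `|(EFin \o H) (x, y)|)%E) //.
  apply: eq_integral => y _; apply: eq_integral => x _.
  by rewrite /= HsE.
have -> : (\int[lebesgue_rV]_(x in D) \int[lebesgue_rV]_(y in D) ((e y - e x) ^+ 2 *
    g x y)%:E =
   \int[lebesgue_rV]_x \int[lebesgue_rV]_y (F (x, y))%:E)%E.
  rewrite integral_mkcond; apply: eq_integral => x _; rewrite patchE.
  case: ifPn => xD.
    rewrite integral_mkcond; apply: eq_integral => y _; rewrite patchE.
    by case: ifPn => yD; rewrite /F /W /f /c/= !patchE !indicE xD ?yD ?(negbTE yD)
        ?mul1r ?mulr0 ?mul0r ?mulr0.
  rewrite [RHS]integral0_eq// => y _.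
  by rewrite /F /W /c/= indicE (negbTE xD) !mul0r mulr0.
rewrite -(fubini_tonelli1 (EFin \o F))//; last 2 first.
- exact/measurable_EFinP.
- by move=> p; rewrite /= lee_fin mulr_ge0 ?sqr_ge0.
under eq_integral do rewrite /= FE EFinD.
rewrite (integralD measurableT iH iHs).
rewrite -integral12_prod_meas1// -[X in (_ + X)%E]integral21_prod_meas1//.
have -> : (\int[lebesgue_rV]_y fubini_G lebesgue_rV (EFin \o Hs) y =
           \int[lebesgue_rV]_x fubini_F lebesgue_rV (EFin \o H) x)%E.
  apply: eq_integral => y _; rewrite /fubini_G /fubini_F.
  by apply: eq_integral => x _; rewrite /= HsE.
set I := (\int[lebesgue_rV]_x _)%E.
suff : (`|I| <= (E * r / 2)%:E * lebesgue_rV Omega + (2 * b * E * m)%:E * lebesgue_rV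
    (collar Omega delta))%E.
  set J := (_ + _)%E => IJ.
  rewrite [X in (_ <= X)%E](_ : _ = J + J)%E; last first.
    have q1 : 0 <= E * r / 2 by rewrite !mulr_ge0.
    have q2 : 0 <= 2 * b * E * m by rewrite !mulr_ge0.
    rewrite (_ : (E * r)%:E = (E * r / 2)%:E + (E * r / 2)%:E)%E; last first.
      by rewrite -EFinD; congr EFin; lra.
    rewrite (_ : (4 * b * E * m)%:E = (2 * b * E * m)%:E + (2 * b * E * m)%:E)%E;
        last first.
      by rewrite -EFinD; congr EFin; ring.
    by rewrite /J addeACA !ge0_muleDl// lee_fin.
  have IJ' : (I <= J)%E by apply: le_trans IJ; exact: lee_abs.
  exact: leeD.
have mI : measurable_fun setT (fubini_F lebesgue_rV (EFin \o H)).
  exact: (measurable_fubini_F iH).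
apply: le_trans (le_abse_integral _ measurableT mI) _.
pose G x : R := E * r / 2 * \1_Omega x + 2 * b * E * m * \1_(collar Omega delta) x.
have nG x : (0 <= (\1_Omega x : R)) /\ (0 <= (\1_(collar Omega delta) x : R)).
  by rewrite !indicE.
apply: (@le_trans _ _ (\int[lebesgue_rV]_x (G x)%:E)%E); last first.
  rewrite (eq_integral (fun x => ((E * r / 2)%:E * (\1_Omega x)%:E + (2 * b * E *
      m)%:E * (\1_(collar Omega delta) x)%:E)%E)); last by [].
  have q1 : 0 <= E * r / 2 by rewrite !mulr_ge0.
  have q2 : 0 <= 2 * b * E * m by rewrite !mulr_ge0.
  rewrite ge0_integralD//; last 4 first.
  - by move=> x _; rewrite mule_ge0// lee_fin.
  - by apply: emeasurable_funM => //; exact/measurable_EFinP.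
  - by move=> x _; rewrite mule_ge0// lee_fin.
  - by apply: emeasurable_funM => //; exact/measurable_EFinP.
  rewrite !ge0_integralZl_EFin//; try exact/measurable_EFinP.
  by rewrite !integral_indic// !setIT.
apply: ge0_le_integral => //.
- exact: measurableT_comp.
- by apply/measurable_EFinP; apply: measurable_funD; apply: measurable_funM.
move=> x _; rewrite /fubini_F /=.
(* For x in Omega the kernel already vanishes off [D], so the inner integral is the whole-space one
   of [nonlocal_op]. *)
have [Ox|nOx] := pselect (Omega x).
  have Dx : D x by left.
  have HE y : H (x, y) = - e x * ((e y - e x) * g x y).
    rewrite /H /W /f /c/= !patchE !indicE !(mem_set Dx).
    have [Dy|nDy] := pselect (D y); first by rewrite mem_set// !mul1r mulrA.
    by rewrite (kernel_outside kg oO Ox nDy) !mulr0.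
  have iZ := iex x Ox.
  under eq_integral do rewrite HE EFinM.
  rewrite (integralZl measurableT iZ) -[X in (_ * X)%E]fineK; last first.
    exact: (integrable_fin_num measurableT iZ).
  rewrite -EFinM lee_fin normrM normrN /G !indicE mem_set// mulr1.
  apply: (@le_trans _ _ (E * r / 2)); last by rewrite lerDl !mulr_ge0.
  rewrite -mulrA; apply: ler_pM => //; first exact: eE.
  by have := er x Ox; rewrite /nonlocal_op normrM ger0_norm// /Rintegral; lra.
have [cx|ncx] := pselect (collar Omega delta x).
  have Dx : D x by right.
  apply: (@le_trans _ _ (\int[lebesgue_rV]_y `|(H (x, y))%:E|)%E).
    by apply: le_abse_integral => //; exact/measurable_EFinP.
  apply: le_trans (intHx x b _) _; first by rewrite /f patchE mem_set// eb.
  rewrite lee_fin /G !indicE memNset// mem_set// /c indicE mem_set//.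
  by rewrite mulr0 add0r mulr1 mul1r; lra.
have nDx : ~ D x by case.
rewrite integral0_eq; last first.
  by move=> y _; rewrite /H /W /c/= indicE memNset// !mul0r mulr0.
by rewrite abse0 lee_fin /G addr_ge0// mulr_ge0 ?mulr_ge0//; have [] := nG x.
Qed.

End energy_bound.

(** * Estimates at a fixed horizon *)

Lemma partial_eq_open (R : realType) (d : nat) (A : set 'rV[R]_d) (f g : 'rV[R]_d ->
    R) i x :
  open A -> (forall y, A y -> f y = g y) -> A x -> partial i f x = partial i g x.
Proof.
move=> oA fg Ax; apply: near_eq_derive.
have : nbhs x A by apply: open_nbhs_nbhs.
exact: filterS.
Qed.

(** Derivatives are local, so on the open set Omega the extension inherits the local equation of
    u0. *)
Lemma laplacian_eq_open (R : realType) (d : nat) (A : set 'rV[R]_d) (f g : 'rV[R]_d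
    -> R) x :
  open A -> (forall y, A y -> f y = g y) -> A x -> laplacian f x = laplacian g x.
Proof.
move=> oA fg Ax; apply: eq_bigr => i _; apply: (partial_eq_open _ oA) => // y Ay.
exact: (partial_eq_open _ oA).
Qed.

Lemma le_sup_norm (R : realType) (d : nat) (A : set 'rV[R]_d) (f : 'rV[R]_d -> R) (C
    : R) :
  (sup_norm A f <= C%:E)%E <-> (forall x, A x -> `|f x| <= C).
Proof.
split=> [h x Ax|h].
  rewrite -lee_fin (le_trans _ h)//; apply: ereal_sup_ubound; by exists x.
by apply: ub_ereal_sup => _ [x Ax <-]; rewrite lee_fin h.
Qed.

Section fixed_horizon.
Context {R : realType} (n : nat) (delta : R) (g : 'rV[R]_n.+1 -> 'rV[R]_n.+1 -> R).
Hypothesis kg : kernel_conditions delta g.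
Local Notation d := n.+1.
Variable Omega : set 'rV[R]_d.
Hypothesis oO : open Omega.
Local Notation D := (ext_domain Omega delta).
Local Notation m := (\int[lebesgue_rV]_(z in [set: 'rV[R]_d]) g 0 z).

(** At a single point of Omega the ball lies in the extended domain, so the truncated mass there is
    the full mass, which by translation is the same everywhere. *)
Lemma kernel_mass_bound (G : R) : Omega !=set0 ->
  (kernel_mass Omega delta g <= G%:E)%E ->
  (\int[lebesgue_rV]_z (g 0 z)%:E < +oo)%E /\ m <= G.
Proof.
move=> [x0 Ox0] hG.
have mD : measurable D by apply: open_measurable_rV; exact: open_ext_domain.
have le : (\int[lebesgue_rV]_z (g 0 z)%:E <= G%:E)%E.
  apply: le_trans hG.
  have mg : measurable_fun setT (g x0) by exact: (measurable_kernel_at kg).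
  have -> : (\int[lebesgue_rV]_z (g 0 z)%:E = \int[lebesgue_rV]_y (g x0 y)%:E)%E.
    rewrite -(@integral_translate R d x0 (EFin \o g x0)); last exact/measurable_EFinP.
    by apply: eq_integral => z _; rewrite /= (kernel_translate kg x0) addrK.
  apply: (@le_trans _ _ (\int[lebesgue_rV]_(y in eball x0 delta `&` D) (g x0
      y)%:E)%E); last first.
    by apply: ereal_sup_ubound; exists x0 => //; left.
  rewrite [leRHS]integral_mkcond le_eqVlt; apply/orP; left; apply/eqP.
  apply: eq_integral => y _; rewrite patchE; case: ifPn => // /negP yn.
  rewrite (kernel_support kg)// => xy; apply: yn; apply/mem_set; split=> //.
  exact: eball_ext_domain oO Ox0 xy.
have fin : (\int[lebesgue_rV]_z (g 0 z)%:E < +oo)%E by exact: le_lt_trans le (ltry _).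
split=> //; rewrite -lee_fin /Rintegral fineK// ge0_fin_numE//.
by apply: integral_ge0 => z _; rewrite lee_fin (kernel_ge0 kg).
Qed.

Hypothesis g_fin : (\int[lebesgue_rV]_z (g 0 z)%:E < +oo)%E.
Variables (M : R) (D1 : set 'rV[R]_d) (U f f0 gd u : 'rV[R]_d -> R) (M4 : R).
Hypotheses (DM : D `<=` cube M) (DD1 : D `<=` D1) (oD1 : open D1) (UD1 : Cb 4 D1 U).
Hypotheses (M40 : 0 <= M4)
  (UM4 : forall y z, D1 y -> `|dir_derive 4 z U y| <= M4 * (\sum_i `|z ord0 i|) ^+ 4).
Hypotheses (delta0 : 0 < delta) (Uf0 : forall x, Omega x -> - laplacian U x = f0 x)
  (hu : nonlocal_solution Omega delta g f gd u).
Variables (a b : R).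
Hypotheses (a0 : 0 <= a) (b0 : 0 <= b)
  (ff0 : forall x, Omega x -> `|f x - f0 x| <= a)
  (gU : forall y, collar Omega delta y -> `|gd y - U y| <= b).

Let r := a + 2 * M4 * d%:R ^+ 5 * delta ^+ 2.
Let E := b + r * M ^+ 2.

(** [r] adds the data error to the consistency error and bounds L e, and [E] bounds e through the
    barrier. [D1] stands for a domain that does not shrink with [delta], so that [M4] is uniform. *)
Lemma fixed_horizon_estimates :
  (forall x, Omega x -> `|u x - U x| <= E) /\
  (\int[lebesgue_rV]_(x in D) \int[lebesgue_rV]_(y in D)
      (((u y - U y) - (u x - U x)) ^+ 2 * g x y)%:E <=
   (E * r)%:E * lebesgue_rV Omega + (4 * b * E * m)%:E * lebesgue_rV (collar Omega
       delta))%E.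
Proof.
have [iu iux Lu uc] := hu.
have r0 : 0 <= r by rewrite addr_ge0// mulr_ge0// ?sqr_ge0// !mulr_ge0 ?exprn_ge0.
have E0 : 0 <= E by rewrite addr_ge0// mulr_ge0// sqr_ge0.
have mD : measurable D by apply: open_measurable_rV; exact: open_ext_domain.
have Dfin : (lebesgue_rV D < +oo)%E := lebesgue_rV_lty mD DM.
have xD x : Omega x -> forall y, enorm (y - x) < delta -> D1 y.
  by move=> Ox y yx; apply: DD1; exact: eball_ext_domain oO Ox yx.
pose e y := u y - U y.
have [B B0 UB] := Cb_bounded UD1.
have mU : measurable_fun D U.
  apply: measurable_funS (Cb_measurable oD1 UD1) => //; exact: open_measurable_rV.
have iU : lebesgue_rV.-integrable D (EFin \o U).
  apply: measurable_bounded_integrable => //; exists B; split; first exact: num_real.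
  by move=> N BN y Dy /=; rewrite (le_trans _ (ltW BN))// UB//; exact: DD1.
have ie : lebesgue_rV.-integrable D (EFin \o e) by exact: (integrableB mD iu iU).
have iUx x : Omega x -> lebesgue_rV.-integrable setT (EFin \o (fun y => (U y - U x) *
    g x y)).
  by move=> Ox; apply: (integrable_smooth_difference kg g_fin oD1 UD1); exact: xD.
have iex x : Omega x -> lebesgue_rV.-integrable setT (fun y => ((e y - e x) * g x y)%:E).
  move=> Ox; apply: eq_integrable (integrableB measurableT (iux x Ox) (iUx x Ox)) =>
      // y _ /=.
  by rewrite -EFinB; congr EFin; rewrite /e; ring.
have Le x : Omega x -> `|nonlocal_op g e x| <= r.
  move=> Ox.
  have LeE : nonlocal_op g e x = - (f x - f0 x) - (nonlocal_op g U x - laplacian U x).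
    rewrite -Lu// -Uf0// opprB opprK -[nonlocal_op g U x]opprK.
    have -> : nonlocal_op g e x = nonlocal_op g u x - nonlocal_op g U x.
      rewrite /nonlocal_op -mulrBr -RintegralB//; [|exact: iux|exact: iUx].
      by congr (2 * _); apply: eq_Rintegral => y _; rewrite /e; ring.
    by ring.
  rewrite LeE (le_trans (ler_normB _ _))// normrN lerD ?ff0//.
  by apply: (nonlocal_consistency kg g_fin oD1 UD1) => //; exact: xD.
have eb y : collar Omega delta y -> `|e y| <= b.
  by move=> cy; rewrite /e uc// gU.
have eO x : Omega x -> `|e x| <= E.
  move=> Ox; apply: le_trans (nonlocal_error_bound kg g_fin oO DM r0 ie iex Le eb Ox) _.
  (* The barrier yields r M^2 / 2; the factor 1/2 is dropped. *)
  rewrite /E lerD2l mulrA ler_wpM2r ?sqr_ge0// invfM -!mulrA mulVf ?pnatr_eq0// mulr1.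
  by rewrite ler_piMr// invf_le1//; lra.
split=> //.
apply: (energy_bound kg g_fin oO DM E0 b0 r0) => //.
- by apply/measurable_EFinP; exact: measurable_int ie.
- move=> x [Ox|cx]; first exact: eO.
  by rewrite (le_trans (eb x cx))// lerDl mulr_ge0// sqr_ge0.
Qed.

End fixed_horizon.

(** * Constants independent of the horizon *)

Unset Implicit Arguments.

Theorem theorem2p2 (R : realType) (d : nat) (d_gt0 : (0 < d)%N)
    (Omega : set 'rV[R]_d) (hOmega : bounded_open_polyhedron Omega)
    (u0 f0 g0 : 'rV[R]_d -> R)
    (hu0 : Cb 4 Omega u0)
    (hlocal : local_solution Omega f0 g0 u0)
    (delta0 : R) (delta0_gt0 : 0 < delta0)
    (gamma : R -> 'rV[R]_d -> 'rV[R]_d -> R)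
    (hgamma : forall delta, 0 < delta < delta0 ->
       kernel_conditions delta (gamma delta))
    (hG : big_O_power
       (fun delta => kernel_mass Omega delta (gamma delta)) (- 2))
    (f g u : R -> 'rV[R]_d -> R)
    (hnonlocal : forall delta, 0 < delta < delta0 ->
       nonlocal_solution Omega delta (gamma delta)
         (f delta) (g delta) (u delta))
    (ut0 : 'rV[R]_d -> R)
    (hut0 : forall delta, 0 < delta < delta0 ->
       Cn_extension 4 Omega delta u0 ut0)
    (mu : nat) (hmu : mu = 0%N \/ mu = 1%N)
    (hf : big_O_power
       (fun delta => sup_norm Omega (fun x => f delta x - f0 x)) 2)
    (hg : big_O_power
       (fun delta => sup_norm (collar Omega delta)
          (fun y => g delta y - ut0 y)) (2 + mu%:R)) :
  big_O_power
    (fun delta => sup_norm Omega (fun x => u delta x - u0 x)) 2 /\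
  big_O_power
    (fun delta => energy_norm Omega delta (gamma delta)
       (fun x => u delta x - ut0 x)) ((3 + mu%:R) / 2).
Proof.
destruct d as [|n]; first by [].
have [bO [ps OE]] := hOmega.
have oO : open Omega by rewrite OE; exact: open_interior.
(* The kernel mass is read off at a point of Omega; if Omega is empty, so is the collar, and both
   estimates are trivial. *)
have [Om0|Om0] := pselect (Omega !=set0); last first.
  have O0 : Omega = set0 by apply/seteqP; split=> x // Ox; apply: Om0; exists x.
  split; exists 0; apply: nearW => delta; rewrite mul0r.
    by apply/le_sup_norm => x; rewrite O0.
  rewrite /energy_norm (_ : ext_domain Omega delta = set0).
    by rewrite integral_set0 poweR0r// invr_neq0.
  rewrite ext_domainE O0 set0U /boundary closure0 set0D.
  by rewrite bigcup_set0.
(* Strictly below [delta0], so that the extension is available there, and at most 1, so that higher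
   powers of [delta] are smaller and the common cube applies. *)
pose delta1 := Num.min (delta0 / 2) 1.
have d1_gt0 : 0 < delta1 by rewrite lt_min divr_gt0//=.
have d1_lt : delta1 < delta0.
  by rewrite gt_min; apply/orP; left; lra.
have d1_le1 : delta1 <= 1 by rewrite ge_min lexx orbT.
have [UD1 UO] := hut0 delta1 (introT andP (conj d1_gt0 d1_lt)).
have oD1 : open (ext_domain Omega delta1) by exact: open_ext_domain.
have [M M0 OM] := ext_domain_bounded oO bO.
have [M4 M40 UM4] := dir_derive_bound UD1.
have [Cv Cv0 [rv rv0 hv]] := collar_volume hOmega.
have [G {}hG] := hG.
have [Cf {}hf] := hf.
have [Cg {}hg] := hg.
(* The constants from the O-hypotheses may have any sign, hence the absolute values. [r1] and [E1]
   bound L e and e in units of delta^2, and [Q] the squared energy in units of delta^(3+mu). *)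
pose r1 := `|Cf| + 2 * M4 * n.+1%:R ^+ 5.
pose E1 := `|Cg| + r1 * M ^+ 2.
pose V := fine (lebesgue_rV Omega).
pose Q := E1 * r1 * V + 4 * `|Cg| * E1 * `|G| * Cv.
have r10 : 0 <= r1 by rewrite addr_ge0// !mulr_ge0 ?exprn_ge0.
have E10 : 0 <= E1 by rewrite addr_ge0// mulr_ge0// sqr_ge0.
have V0 : 0 <= V by rewrite fine_ge0.
have VE : lebesgue_rV Omega = V%:E.
  rewrite fineK// ge0_fin_numE//.
  apply: (lebesgue_rV_lty (r := M)); first exact: open_measurable_rV.
  by move=> x Ox; apply: (OM delta1) => //; left.
have Q0 : 0 <= Q by rewrite addr_ge0// !mulr_ge0.
pose energy delta := (\int[lebesgue_rV]_(x in ext_domain Omega delta)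
  \int[lebesgue_rV]_(y in ext_domain Omega delta)
    (((u delta y - ut0 y) - (u delta x - ut0 x)) ^+ 2 * gamma delta x y)%:E)%E.
pose good delta := [/\ 0 < delta,
  forall x, Omega x -> `|u delta x - ut0 x| <= E1 * delta ^+ 2 &
  (energy delta <= (Q * delta ^+ (3 + mu))%:E)%E].
have main : \forall delta \near 0^'+, good delta.
  near=> delta.
  have dpos : 0 < delta by near: delta; exact: nbhs_right_gt.
  have dlt : delta < delta1 by near: delta; exact: nbhs_right_lt.
  have dv : delta < rv by near: delta; exact: nbhs_right_lt.
  have dle1 : delta <= 1 by rewrite ltW// (lt_le_trans dlt).
  have d00 : 0 < delta < delta0 by rewrite dpos (lt_trans dlt).
  have kg := hgamma _ d00.
  have Gd : (kernel_mass Omega delta (gamma delta) <= (`|G| * (delta ^+ 2)^-1)%:E)%E.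
    have : (kernel_mass Omega delta (gamma delta) <= (G * delta `^ (- 2))%:E)%E by
        near: delta.
    move/le_trans; apply; rewrite lee_fin powRN powR_mulrn ?(ltW dpos)//.
    by rewrite ler_wpM2r ?ler_norm// invr_ge0 sqr_ge0.
  have fd : forall x, Omega x -> `|f delta x - f0 x| <= `|Cf| * delta ^+ 2.
    apply: (@le_sup_norm R _ Omega (fun x => f delta x - f0 x) _).1.
    have : (sup_norm Omega (fun x => f delta x - f0 x)%R <= (Cf * delta `^ 2)%:E)%E
        by near: delta.
    move/le_trans; apply; rewrite lee_fin powR_mulrn ?(ltW dpos)//.
    by rewrite ler_wpM2r ?ler_norm// sqr_ge0.
  have gd : forall y, collar Omega delta y -> `|g delta y - ut0 y| <= `|Cg| * delta
      ^+ (2 + mu).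
    apply: (@le_sup_norm R _ (collar Omega delta) (fun y => g delta y - ut0 y) _).1.
    have : (sup_norm (collar Omega delta) (fun y => g delta y - ut0 y)%R <= (Cg *
        delta `^ (2 + mu%:R))%:E)%E by near: delta.
    move/le_trans; apply; rewrite lee_fin -natrD powR_mulrn ?(ltW dpos)//.
    by rewrite ler_wpM2r ?ler_norm// exprn_ge0// ltW.
  have [g_fin mG] := kernel_mass_bound kg oO Om0 Gd.
  have a0 : 0 <= `|Cf| * delta ^+ 2 by rewrite mulr_ge0// sqr_ge0.
  have b0 : 0 <= `|Cg| * delta ^+ (2 + mu) by rewrite mulr_ge0// exprn_ge0// ltW.
  have Uf0 x : Omega x -> - laplacian ut0 x = f0 x.
    by move=> Ox; rewrite (laplacian_eq_open oO UO Ox); exact: hlocal.1.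
  have [Hu He] := fixed_horizon_estimates kg oO g_fin (OM _ dle1)
    (ext_domainS (ltW dlt)) oD1 UD1 M40 (fun y z Dy => UM4 y z Dy) dpos Uf0
    (hnonlocal _ d00) a0 b0 fd gd.
  have rE : `|Cf| * delta ^+ 2 + 2 * M4 * n.+1%:R ^+ 5 * delta ^+ 2 = r1 * delta ^+ 2.
    by rewrite /r1; ring.
  have d2 : delta ^+ (2 + mu) <= delta ^+ 2.
    by rewrite exprD ler_piMr ?sqr_ge0// exprn_ile1// ltW.
  have EE : `|Cg| * delta ^+ (2 + mu) + r1 * delta ^+ 2 * M ^+ 2 <= E1 * delta ^+ 2.
    rewrite /E1 [leRHS]mulrDl; apply: lerD; first by rewrite ler_wpM2l.
    by rewrite mulrAC.
  rewrite rE in Hu He.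
  split=> //; first by move=> x /Hu h; exact: le_trans EE.
  apply: le_trans He _; rewrite VE.
  set m := Rintegral _ _ _ in mG *.
  have m0 : 0 <= m by apply: Rintegral_ge0 => z _; exact: (kernel_ge0 kg).
  set b := `|Cg| * delta ^+ (2 + mu) in b0 EE *.
  set E := b + _ in EE *.
  have E0 : 0 <= E by rewrite addr_ge0// mulr_ge0// ?sqr_ge0// mulr_ge0// sqr_ge0.
  apply: (@le_trans _ _ ((E1 * delta ^+ 2 * (r1 * delta ^+ 2) * V)%:E +
      (4 * b * (E1 * delta ^+ 2) * (`|G| * (delta ^+ 2)^-1) * (Cv * delta))%:E)%E).
    apply: leeD.
      by rewrite -EFinM lee_fin ler_wpM2r// ler_wpM2r// mulr_ge0// sqr_ge0.
    rewrite [leRHS]EFinM; apply: lee_pmul.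
    - by rewrite lee_fin (mulr_ge0 (mulr_ge0 (mulr_ge0 _ b0) E0) m0).
    - exact: measure_ge0.
    - rewrite lee_fin; apply: ler_pM => //.
        by rewrite (mulr_ge0 (mulr_ge0 _ b0) E0).
      by rewrite ler_wpM2l// (mulr_ge0 _ b0).
    - by apply: hv; rewrite dpos.
  rewrite -EFinD lee_fin.
  (* The delta^2 of the error cancels the delta^-2 of the mass; boundary data and collar volume
     leave delta^(2+mu) times delta. *)
  have -> : 4 * b * (E1 * delta ^+ 2) * (`|G| * (delta ^+ 2)^-1) * (Cv * delta) =
      4 * `|Cg| * E1 * `|G| * Cv * delta ^+ (3 + mu).
    rewrite (_ : delta ^+ (3 + mu) = delta ^+ (2 + mu) * delta); last by rewrite -exprSr.
    by rewrite /b; field; rewrite gt_eqF.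
  rewrite /Q [leRHS]mulrDl lerD2r.
  have -> : E1 * delta ^+ 2 * (r1 * delta ^+ 2) * V = E1 * r1 * V * delta ^+ 4 by ring.
  rewrite ler_wpM2l ?mulr_ge0//.
  (* Omega contributes delta^4, which equals delta^(3+mu) for mu = 1 and is smaller for mu = 0. *)
  case: hmu => ->; rewrite ?lexx//.
  by rewrite exprS ler_piMl// exprn_ge0// ltW.
split; [exists E1|exists (Q `^ 2^-1)]; near=> delta.
  have [dpos h _] : good delta by near: delta.
  apply/le_sup_norm => x Ox; rewrite -UO// powR_mulrn ?(ltW dpos)//.
  exact: h.
have [dpos _ h] : good delta by near: delta.
(* The bound is written as the square root of Q delta^(3+mu), so that monotonicity of the square
   root on nonnegative quantities concludes. *)
rewrite powRrM -natrD powR_mulrn ?(ltW dpos)// -powRM ?exprn_ge0 ?(ltW dpos)//.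
rewrite -poweR_EFin /energy_norm; apply: gt0_ler_poweR => //.
- rewrite in_itv/= leey andbT; apply: integral_ge0 => x _; apply: integral_ge0 => y _.
  rewrite lee_fin mulr_ge0 ?sqr_ge0//.
  have dlt : delta < delta0 by near: delta; exact: nbhs_right_lt.
  by apply: (kernel_ge0 (hgamma delta _)); rewrite dpos.
- by rewrite in_itv/= leey andbT lee_fin mulr_ge0// exprn_ge0// ltW.
Unshelve. all: by end_near.
Qed.
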